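(* Let $d\ge1$, let $\mathcal K\subseteq\mathbb R^d$ be a compact convex set of diameter $1$, let $L>0$, and let $\mathcal L$ be a family of $L$-Lipschitz loss functions $\ell:\mathcal K\to\mathbb R$. There is a constant $C_d$ depending only on $d$ such that for every $T\ge2$ there is an online algorithm outputting finitely supported distributions $\mathbf x_t\in\Delta(\mathcal K)$ whose full swap regret, against every (possibly adaptive) sequence $\ell_1,\dots,\ell_T\in\mathcal L$, satisfies: (i) with no further assumption: $\mathrm{FullSwapReg}\le C_d\,L\,T^{\frac{d+1}{d+2}}\log T$; (ii) if every $\ell\in\mathcal L$ is $\beta$-smooth: $\mathrm{FullSwapReg}\le C_d\,(L+\beta)\,T^{\frac{d+2}{d+4}}\log T$; (iii) if every $\ell\in\mathcal L$ is concave (in particular linear): $\mathrm{FullSwapReg}\le C_d\,L\,T^{\frac{d+1}{d+3}}\log T$; (iv) if every $\ell\in\mathcal L$ is $\alpha$-strongly convex: $\mathrm{FullSwapReg}\le C_d\,L\,(L/\alpha)^{\frac1{d+1}}\,T^{\frac d{d+1}}\log T$; (v) if every $\ell\in\mathcal L$ is $\alpha$-strongly convex and $\beta$-smooth: $\mathrm{FullSwapReg}\le C_d\,L\,\big(\tfrac{\beta}{L}+\tfrac{L}{\alpha}\big)\,T^{\frac d{d+2}}\log T$. (The algorithm may depend on $T,d,L,\alpha,\beta$ and $\mathcal K$.)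
   Context: Online protocol: in each round $t=1,\dots,T$ the learner, knowing $\ell_1,\dots,\ell_{t-1}$, outputs a finitely supported probability distribution $\mathbf x_t$ on $\mathcal K$; then the adversary, knowing $\mathbf x_1,\dots,\mathbf x_t$, reveals $\ell_t\in\mathcal L$. The full swap regret is $$\mathrm{FullSwapReg}(\mathbf x_{1:T},\ell_{1:T})=\sup_{\phi:\mathcal K\to\mathcal K}\sum_{t=1}^T\Big(\mathbb E_{s\sim\mathbf x_t}[\ell_t(s)]-\mathbb E_{s\sim\mathbf x_t}[\ell_t(\phi(s))]\Big),$$ the supremum over all (arbitrary) maps $\phi$. A function $\ell$ is $L$-Lipschitz if $|\ell(x)-\ell(y)|\le L\|x-y\|_2$; $\alpha$-strongly convex if for all $x,y\in\mathcal K$ and every subgradient $\nabla\ell(x)$, $\ell(y)-\ell(x)-\nabla\ell(x)^\top(y-x)\ge\frac\alpha2\|y-x\|^2$; $\beta$-smooth if it is differentiable and $\ell(y)-\ell(x)-\nabla\ell(x)^\top(y-x)\le\frac\beta2\|y-x\|^2$ for all $x,y\in\mathcal K$. *)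

(* Defs.v *)
From HB Require Import structures.
From mathcomp Require Import all_boot all_order all_algebra.
From mathcomp Require Import all_classical all_reals all_analysis.
From mathcomp Require Import Rstruct Rstruct_topology.


Set Implicit Arguments.
Unset Strict Implicit.
Unset Printing Implicit Defensive.

Import Order.TTheory GRing.Theory Num.Theory.
Import numFieldNormedType.Exports.
Local Open Scope classical_set_scope.
Local Open Scope ring_scope.

Notation R := Rdefinitions.R.
Notation vec d := 'rV[R]_d.

Definition edot d (x y : vec d) : R := \sum_(i < d) x ord0 i * y ord0 i.
Definition enorm d (x : vec d) : R := Num.sqrt (edot x x).

Definition convex_setE d (K : set (vec d)) : Prop :=
  forall x y (t : R), K x -> K y -> 0 <= t -> t <= 1 ->
    K (t *: x + (1 - t) *: y).

Definition set_diameter d (K : set (vec d)) : R :=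
  sup [set enorm (x - y) | x in K & y in K].

Definition loss_lipschitz d (K : set (vec d)) (L : R) (l : vec d -> R) : Prop :=
  forall x y, K x -> K y -> `|l x - l y| <= L * enorm (x - y).

Definition loss_convex d (K : set (vec d)) (l : vec d -> R) : Prop :=
  forall x y (t : R), K x -> K y -> 0 <= t -> t <= 1 ->
    l (t *: x + (1 - t) *: y) <= t * l x + (1 - t) * l y.

Definition loss_concave d (K : set (vec d)) (l : vec d -> R) : Prop :=
  forall x y (t : R), K x -> K y -> 0 <= t -> t <= 1 ->
    t * l x + (1 - t) * l y <= l (t *: x + (1 - t) *: y).

Definition is_subgradient d (K : set (vec d)) (l : vec d -> R) (x g : vec d) : Prop :=
  forall y, K y -> l x + edot g (y - x) <= l y.

Definition loss_strongly_convex d (K : set (vec d)) (alpha : R) (l : vec d -> R) : Prop :=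
  loss_convex K l /\
  forall x y g, K x -> K y -> is_subgradient K l x g ->
    alpha / 2 * enorm (y - x) ^+ 2 <= l y - l x - edot g (y - x).

Definition loss_smooth d (K : set (vec d)) (beta : R) (l : vec d -> R) : Prop :=
  forall x, K x -> differentiable (l : vec d -> R^o) x /\
    forall y, K y -> l y - l x - 'd (l : vec d -> R^o) x (y - x) <= beta / 2 * enorm (y - x) ^+ 2.

Definition fsdist d := seq (R * vec d).

Definition fsdist_on d (K : set (vec d)) (p : fsdist d) : Prop :=
  (forall wx, wx \in p -> 0 <= wx.1 /\ K wx.2) /\ \sum_(wx <- p) wx.1 = 1.

Definition fs_expect d (p : fsdist d) (f : vec d -> R) : R :=
  \sum_(wx <- p) wx.1 * f wx.2.

(* A (deterministic) online learner maps the history [:: l_1; ...; l_{t-1}]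
   of revealed losses to the distribution x_t; it must output
   distributions on K. *)
Definition learner d := seq (vec d -> R) -> fsdist d.

Definition learner_on d (K : set (vec d)) (alg : learner d) : Prop :=
  forall h, fsdist_on K (alg h).

(* learner_play of the learner against the loss sequence ell (rounds t = 0..T-1
   correspond to rounds 1..T): x_t = alg [:: ell 0; ...; ell (t-1)] *)
Definition learner_play d (alg : learner d) (ell : nat -> vec d -> R) (t : nat) : fsdist d :=
  alg (mkseq ell t).

Definition swap_gain d (T : nat) (xs : nat -> fsdist d) (ell : nat -> vec d -> R)
  (phi : vec d -> vec d) : R :=
  \sum_(t < T) (fs_expect (xs t) (ell t) - fs_expect (xs t) (ell t \o phi)).

Definition FullSwapReg d (K : set (vec d)) (T : nat) (xs : nat -> fsdist d)
  (ell : nat -> vec d -> R) : \bar R :=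
  ereal_sup [set (swap_gain T xs ell phi)%:E |
             phi in [set phi : vec d -> vec d | forall s, K s -> K (phi s)]].

(* There is an online learner on K whose full swap regret over T rounds is
   at most B against every sequence of losses drawn from any family Lfam
   all of whose members satisfy P (the adversary may be adaptive; since the
   learner is deterministic this amounts to every loss sequence). *)
Definition swap_achievable d (K : set (vec d)) (T : nat) (P : (vec d -> R) -> Prop)
  (B : R) : Prop :=
  exists alg : learner d, learner_on K alg /\
    forall Lfam : set (vec d -> R), (forall l, Lfam l -> P l) ->
    forall ell : nat -> vec d -> R, (forall t, Lfam (ell t)) ->
      (FullSwapReg K T (learner_play alg ell) ell <= B%:E)%E.

(* Main.v *)
(* Take finitely many points p_1, ..., p_N of K such that every y in K is a
   convex combination of them with sum_j lam_j l(p_j) <= l(y) + e for all losses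
   at once.  The reduction of Blum and Mansour attaches to every p_i an external
   regret minimizer that plays distributions on the points, and the learner plays
   a stationary distribution of the resulting Markov chain.  For general losses
   the minimizer is Hedge; for strongly convex ones it is follow-the-leader in K
   followed by rounding, whose regret is logarithmic even for weighted losses.
   Points: projecting a net of a sphere around a convex body onto it gives
   s^(n-1) points in dimension n whose hull is s^-2 close to the body
   (Bronshtein-Ivanov).  For concave losses this is applied to K.  In the other
   cases it is applied to the region above a paraboloid over K, one dimension up:
   closeness of the lifted points says that the convex combination has mean
   within s^-2 of y and variance O(s^-2), so that e is O(1/s) for Lipschitz losses
   and O(1/s^2) for smooth ones. *)
Require Import Defs.
From HB Require Import structures.
From mathcomp Require Import all_boot all_order all_algebra.
From mathcomp Require Import all_classical all_reals all_analysis.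
From mathcomp Require Import Rstruct Rstruct_topology.
From mathcomp Require Import ring lra.

Set Implicit Arguments.
Unset Strict Implicit.
Unset Printing Implicit Defensive.

Import Order.TTheory GRing.Theory Num.Theory.
Import numFieldNormedType.Exports.
Local Open Scope classical_set_scope.
Local Open Scope ring_scope.

(** * Euclidean inner product and norm *)

Section InnerProduct.
Context (d : nat).
Implicit Types (x y z : vec d) (a b : R).

Lemma edotC x y : edot x y = edot y x.
Proof. by apply: eq_bigr => i _; rewrite mulrC. Qed.

Lemma edotDl x y z : edot (x + y) z = edot x z + edot y z.
Proof. by rewrite /edot -big_split; apply: eq_bigr => i _; rewrite mxE mulrDl. Qed.

Lemma edotDr x y z : edot x (y + z) = edot x y + edot x z.
Proof. by rewrite edotC edotDl !(edotC x). Qed.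

Lemma edotZl a x y : edot (a *: x) y = a * edot x y.
Proof. by rewrite /edot mulr_sumr; apply: eq_bigr => i _; rewrite mxE mulrA. Qed.

Lemma edotZr a x y : edot x (a *: y) = a * edot x y.
Proof. by rewrite edotC edotZl edotC. Qed.

Lemma edotNl x y : edot (- x) y = - edot x y.
Proof. by rewrite -scaleN1r edotZl mulN1r. Qed.

Lemma edotNr x y : edot x (- y) = - edot x y.
Proof. by rewrite edotC edotNl edotC. Qed.

Lemma edot0l x : edot 0 x = 0.
Proof. by rewrite -(scale0r 0) edotZl mul0r. Qed.

Definition edotE := (edotDl, edotDr, edotNl, edotNr, edotZl, edotZr).

Lemma edot_suml (I : Type) (r : seq I) (P : pred I) (F : I -> vec d) z :
  edot (\sum_(i <- r | P i) F i) z = \sum_(i <- r | P i) edot (F i) z.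
Proof. by elim/big_rec2: _ => [|i u v _ <-]; rewrite ?edot0l ?edotDl. Qed.

Lemma edot_ge0 x : 0 <= edot x x.
Proof. by apply: sumr_ge0 => i _; rewrite -expr2 sqr_ge0. Qed.

Lemma enorm_ge0 x : 0 <= enorm x.
Proof. exact: sqrtr_ge0. Qed.

Lemma enorm_sqr x : enorm x ^+ 2 = edot x x.
Proof. by rewrite sqr_sqrtr // edot_ge0. Qed.

Lemma enormB x y : enorm (x - y) = enorm (y - x).
Proof. by rewrite /enorm -opprB edotNl edotNr opprK. Qed.

Lemma enorm_leP x a : 0 <= a -> (enorm x <= a) = (edot x x <= a ^+ 2).
Proof. by move=> a0; rewrite -enorm_sqr ler_pXn2r // nnegrE enorm_ge0. Qed.

Lemma sqr_coord_le x i : x ord0 i ^+ 2 <= edot x x.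
Proof.
rewrite /edot (bigD1 i) //= -expr2 lerDl.
by apply: sumr_ge0 => j _; rewrite -expr2 sqr_ge0.
Qed.

End InnerProduct.

(** * Stationary distributions and the reduction to weighted external regret *)

Definition simplex N (lam : 'I_N -> R) : Prop :=
  (forall j, 0 <= lam j) /\ \sum_j lam j = 1.

Lemma simplex_le1 N (lam : 'I_N -> R) j : simplex lam -> lam j <= 1.
Proof.
move=> [l0 <-]; rewrite (bigD1 j) //= lerDl.
by apply: sumr_ge0 => k _.
Qed.

Lemma simplex_delta N (i : 'I_N) : simplex (fun j => (j == i)%:R : R).
Proof.
split=> [j|]; first by rewrite ler0n.
by rewrite (bigD1 i) //= eqxx big1 ?addr0 // => j /negPf ->.
Qed.

(* A left fixed vector v of Q satisfies |v| <= |v| Q entrywise; both sides have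
   the same total mass, so |v| is also fixed. *)
Lemma stationary_exists N (Q : 'I_N.+1 -> 'I_N.+1 -> R) :
  (forall i, simplex (Q i)) ->
  exists w, simplex w /\ forall j, \sum_i w i * Q i j = w j.
Proof.
move=> Qs; pose A : 'M[R]_N.+1 := \matrix_(i, j) Q i j - 1%:M.
(* The rows of [Q] sum to 1, so [A] = Q - I annihilates the constant column and is singular. *)
have /det0P[v vN0 vA] : \det A == 0.
  rewrite -det_tr; apply/det0P; exists (const_mx 1).
    apply/eqP => /matrixP/(_ ord0 ord0); rewrite !mxE => /eqP.
    by rewrite oner_eq0.
  apply/rowP => i; rewrite !mxE; under eq_bigr do rewrite !mxE mul1r.
  rewrite big_split /= (Qs i).2 sumrN (bigD1 i) //= eqxx big1 ?addr0 ?subrr //.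
  by move=> j; rewrite eq_sym => /negPf ->.
have vQ j : \sum_i v ord0 i * Q i j = v ord0 j.
  move/rowP/(_ j): vA; rewrite !mxE; under eq_bigr do rewrite !mxE mulrBr.
  rewrite big_split /= sumrN => /eqP; rewrite subr_eq0 => /eqP ->.
  rewrite (bigD1 j) //= eqxx mulr1 big1 ?addr0 // => i /negPf ->.
  by rewrite mulr0.
pose a i := `|v ord0 i|.
have aQ j : a j <= \sum_i a i * Q i j.
  rewrite /a -vQ; apply: le_trans (ler_norm_sum _ _ _) _.
  by apply: ler_sum => i _; rewrite normrM (ger0_norm ((Qs i).1 j)).
have sumaQ : \sum_j \sum_i a i * Q i j = \sum_j a j.
  rewrite exchange_big /=; apply: eq_bigr => i _.
  by rewrite -mulr_sumr (Qs i).2 mulr1.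
have aQE j : \sum_i a i * Q i j = a j.
  apply/eqP; rewrite -subr_eq0; apply/eqP.
  have/psumr_eq0P : forall j, true -> 0 <= \sum_i a i * Q i j - a j.
    by move=> k _; rewrite subr_ge0.
  by apply => //; rewrite big_split /= sumrN sumaQ subrr.
have s0 : 0 < \sum_j a j.
  have [i vi] : exists i, v ord0 i != 0.
    apply/existsP; apply: contraNT vN0 => /existsPn v0.
    by apply/eqP/rowP => i; rewrite mxE; apply/eqP; move: (v0 i); rewrite negbK.
  rewrite (bigD1 i) //= ltr_pwDl ?normr_gt0 //.
  by apply: sumr_ge0 => k _; exact: normr_ge0.
exists (fun i => a i / \sum_j a j); split; first split.
- by move=> j; rewrite divr_ge0 ?normr_ge0 // ltW.
- by rewrite -mulr_suml divff // gt_eqF.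
- move=> j; rewrite -[in RHS]aQE mulr_suml; apply: eq_bigr => i _.
  by rewrite mulrAC.
Qed.

(* The i-th copy of [A] is fed only the fraction w_t of the loss that the
   learner puts on the net point p_i; a and b are the fixed and the
   per-unit-of-weight cost. *)
Definition weighted_regret d N (K : set (vec d)) (P : (vec d -> R) -> Prop)
    (p : 'I_N -> vec d) (T : nat) (a b : R) : Prop :=
  exists A : seq (R * (vec d -> R)) -> 'I_N -> R,
  (forall h, simplex (A h)) /\
  forall (w : nat -> R) (ell : nat -> vec d -> R) y,
    (forall t, 0 <= w t <= 1) -> (forall t, P (ell t)) -> K y ->
    \sum_(t < T) w t * (\sum_j A (mkseq (fun s => (w s, ell s)) t) j * ell t (p j)
                        - ell t y) <= a + b * \sum_(t < T) w t.

(** By stationarity the learner's loss is also the mixture of the copies' losses, so the swap gain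
    splits over i into the weighted regret of copy i against the single point [phi (p i)]. The fixed
    cost [a] is paid by every copy; the weights of a round sum to 1, so [b] is paid once per
    round. *)
Lemma swap_achievable_of_weighted_regret d N (K : set (vec d)) P
    (p : 'I_N.+1 -> vec d) T a b :
  (forall j, K (p j)) -> weighted_regret K P p T a b ->
  swap_achievable K T P (N.+1%:R * a + b * T%:R).
Proof.
move=> Kp [A [As Areg]].
pose hist := seq (('I_N.+1 -> R) * (vec d -> R)).
pose Q (st : hist) i := A [seq (e.1 i, e.2) | e <- st].
have Qs st i : simplex (Q st i) by exact: As.
pose W st := sval (cid (stationary_exists (Qs st))).
have Ws st : simplex (W st) by rewrite /W; case: cid => w [].
have WQ st j : \sum_i W st i * Q st i j = W st j.
  by rewrite /W; case: cid => w [].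
(* The copies need the weights of the earlier rounds, so the losses are replayed and each is stored
   with the distribution that was played against it. *)
pose state := foldl (fun (st : hist) l => rcons st (W st, l)) [::].
have expE st f : fs_expect [seq (W st j, p j) | j <- enum 'I_N.+1] f
    = \sum_j W st j * f (p j).
  by rewrite /fs_expect big_map big_enum.
exists (fun h => [seq (W (state h) j, p j) | j <- enum 'I_N.+1]); split.
  move=> h; split=> [wx /mapP[j _ ->] /=|]; first by split=> //; exact: (Ws _).1.
  by rewrite big_map big_enum /=; exact: (Ws _).2.
move=> Lfam LP ell Lell; apply: ge_ereal_sup => _ [phi /= Kphi <-].
rewrite lee_fin /swap_gain /learner_play.
pose w t := W (state (mkseq ell t)).
have stE t : state (mkseq ell t) = mkseq (fun s => (w s, ell s)) t.
  elim: t => // t IH.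
  by rewrite !mkseqS /state foldl_rcons -/(state _) [in LHS]IH /w IH.
under eq_bigr do rewrite !expE.
have rowE (t : nat) j : \sum_i w t i * A (mkseq (fun s => (w s i, ell s)) t) j = w t j.
  rewrite /w -WQ; apply: eq_bigr => i _; congr (_ * _).
  by rewrite /Q stE /mkseq -map_comp.
have -> : \sum_(t < T) (\sum_j W (state (mkseq ell t)) j * ell t (p j) -
      \sum_j W (state (mkseq ell t)) j * (ell t \o phi) (p j)) =
  \sum_i \sum_(t < T) w t i * (\sum_j A (mkseq (fun s => (w s i, ell s)) t) j
      * ell t (p j) - ell t (phi (p i))).
  rewrite exchange_big /=; apply: eq_bigr => t _.
  under [RHS]eq_bigr do rewrite mulrBr mulr_sumr.
  rewrite [RHS]big_split /= sumrN exchange_big /=; congr (_ - _).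
  apply: eq_bigr => j _; rewrite -/(w t) -rowE mulr_suml.
  by apply: eq_bigr => i _; rewrite mulrA.
have w01 i t : 0 <= w t i <= 1 by rewrite (Ws _).1 (simplex_le1 i (Ws _)).
apply: (@le_trans _ _ (\sum_(i < N.+1) (a + b * \sum_(t < T) w t i))).
  apply: ler_sum => i _; apply: (Areg (fun t => w t i)).
  - by move=> t; exact: w01.
  - by move=> t; exact/LP/Lell.
  - exact/Kphi/Kp.
rewrite big_split /= sumr_const card_ord -mulr_sumr exchange_big /=.
under eq_bigr do rewrite (Ws _).2.
by rewrite sumr_const card_ord mulr_natl.
Qed.

Lemma swap_achievable_le d (K : set (vec d)) T P (B B' : R) :
  B <= B' -> swap_achievable K T P B -> swap_achievable K T P B'.
Proof.
move=> BB' [alg [onK reg]]; exists alg; split=> // Lfam LP ell Lell.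
by apply: le_trans (reg _ LP _ Lell) _; rewrite lee_fin.
Qed.

Lemma fsdist_on_dirac d (K : set (vec d)) x : K x -> fsdist_on K [:: (1, x)].
Proof.
move=> Kx; split=> [wx|]; last by rewrite big_seq1.
by rewrite inE => /eqP -> /=; split.
Qed.

(** For case (v), where [alpha] and [L] are compared through an actual loss: if no loss is
    admissible, there is no sequence to play against and any bound holds. *)
Lemma swap_achievable_vacuous d (K : set (vec d)) T (P : (vec d -> R) -> Prop) B :
  K !=set0 -> (forall l, ~ P l) -> swap_achievable K T P B.
Proof.
move=> [x Kx] nP; exists (fun=> [:: (1, x)]); split=> [h|Lfam LP ell Lell].
  exact: fsdist_on_dirac.
by case: (nP (ell 0%N)); apply/LP/Lell.
Qed.

(** Over diameter 1 a loss varies by at most [L]. Case (iv) falls back on this when the desired net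
    would have scale below 1. *)
Lemma swap_achievable_trivial d (K : set (vec d)) T (P : (vec d -> R) -> Prop) L :
  K !=set0 -> 0 <= L -> (forall x y, K x -> K y -> enorm (x - y) <= 1) ->
  (forall l, P l -> loss_lipschitz K L l) -> swap_achievable K T P (L * T%:R).
Proof.
move=> [x Kx] L0 diam PL; exists (fun=> [:: (1, x)]).
split=> [h|Lfam LP ell Lell]; first exact: fsdist_on_dirac.
apply: ge_ereal_sup => _ [phi /= Kphi <-]; rewrite lee_fin /swap_gain.
have -> : L * T%:R = \sum_(t < T) L by rewrite sumr_const card_ord mulr_natr.
apply: ler_sum => t _; rewrite /learner_play /fs_expect !big_seq1 /= !mul1r.
apply: le_trans (ler_norm _) _.
apply: le_trans (PL _ (LP _ (Lell t)) _ _ Kx (Kphi _ Kx)) _.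
by rewrite ler_piMr // diam //; exact: Kphi.
Qed.

(** The weights are fixed before the loss: follow-the-leader rounds its point before the loss is
    revealed, and Hedge is compared with one mixture over all rounds. *)
Definition roundable d N (K : set (vec d)) (P : (vec d -> R) -> Prop)
    (p : 'I_N -> vec d) (e : R) : Prop :=
  forall y, K y -> exists lam, simplex lam /\
    forall l, P l -> \sum_j lam j * l (p j) <= l y + e.

(** * Hedge under weighted losses *)

Lemma expR_quad_bound (x : R) : `|x| <= 1 / 2 -> expR x <= 1 + x + 2 * x ^+ 2.
Proof.
rewrite ler_norml => /andP[lo hi].
have := expR_ge1Dx (- x); have := expR_gt0 x.
have : expR x * expR (- x) = 1 by rewrite -exp.expRD subrr exp.expR0.
move: (expR x) (expR (- x)) => u v uv u0 v1.
have h : u * (1 - x) <= u * v by rewrite ler_wpM2l // ltW.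
(* Since [expR x * (1 - x) <= 1], it is enough that the right side times [1 - x] is at least 1. *)
rewrite -(ler_pM2r (_ : 0 < 1 - x)); last lra.
apply: le_trans h _; rewrite uv.
have -> : (1 + x + 2 * x ^+ 2) * (1 - x) = 1 + x ^+ 2 * (1 - 2 * x) by ring.
rewrite lerDl mulr_ge0 ?sqr_ge0 //; lra.
Qed.

Lemma simplex_mean_dist N (lam a : 'I_N -> R) (L : R) j : simplex lam ->
  (forall i k, `|a i - a k| <= L) -> `|\sum_i lam i * a i - a j| <= L.
Proof.
move=> [l0 l1] aL.
have -> : \sum_i lam i * a i - a j = \sum_i lam i * (a i - a j).
  under [RHS]eq_bigr do rewrite mulrBr.
  by rewrite big_split /= sumrN -mulr_suml l1 mul1r.
apply: le_trans (ler_norm_sum _ _ _) _.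
rewrite -[leRHS]mul1r -l1 mulr_suml; apply: ler_sum => i _.
by rewrite normrM ger0_norm // ler_wpM2l.
Qed.

Section Hedge.
Context (d N : nat) (p : 'I_N.+1 -> vec d) (L eta : R).
Implicit Types (h : seq (R * (vec d -> R))) (l : vec d -> R) (w : R).

Definition cum_loss h j : R := \sum_(e <- h) e.1 * e.2 (p j).
Definition hedge_pot h : R := \sum_j expR (- eta * cum_loss h j).
Definition hedge h j : R := expR (- eta * cum_loss h j) / hedge_pot h.

Lemma hedge_pot_gt0 h : 0 < hedge_pot h.
Proof.
rewrite /hedge_pot (bigD1 ord0) //= ltr_pwDl ?expR_gt0 //.
by apply: sumr_ge0 => j _; exact: expR_ge0.
Qed.

Lemma hedge_simplex h : simplex (hedge h).
Proof.
split=> [j|]; first by rewrite divr_ge0 ?expR_ge0 // ltW // hedge_pot_gt0.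
by rewrite -mulr_suml divff // gt_eqF // hedge_pot_gt0.
Qed.

(** Once the losses are centred at their mean [m], the linear term of the exponential averages to
    zero. The quadratic term is bounded using w^2 <= w, so that the error is linear in the weight,
    as a cost per unit of weight must be. *)
Lemma hedge_pot_step h l w : 0 <= eta -> 0 <= L -> eta * L <= 1 / 2 ->
  (forall j k, `|l (p j) - l (p k)| <= L) -> 0 <= w <= 1 ->
  hedge_pot (rcons h (w, l)) <= hedge_pot h *
    expR (- eta * (w * \sum_j hedge h j * l (p j)) + 2 * eta ^+ 2 * L ^+ 2 * w).
Proof.
move=> eta0 L0 etaL lL /andP[w0 w1]; set m := \sum_j _.
pose x j := eta * w * (m - l (p j)).
have [h0 h1] := hedge_simplex h.
have ew0 : 0 <= eta * w by rewrite mulr_ge0.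
have xb j : `|x j| <= eta * w * L.
  rewrite normrM ger0_norm // ler_wpM2l //.
  exact: (simplex_mean_dist (a := fun j => l (p j)) j (hedge_simplex h) lL).
have etaw : eta * w * L <= eta * L by rewrite ler_wpM2r // ler_piMr.
have EE j : expR (- eta * cum_loss (rcons h (w, l)) j) =
    hedge_pot h * expR (- eta * (w * m)) * (hedge h j * expR (x j)).
  rewrite /hedge mulrACA (mulrCA (hedge_pot h)) divff ?gt_eqF ?hedge_pot_gt0 //.
  rewrite mulr1 -!exp.expRD /cum_loss -cats1 big_cat big_seq1 /= /x.
  by congr expR; ring.
rewrite {1}/hedge_pot; under eq_bigr do rewrite EE.
rewrite -mulr_sumr exp.expRD [leRHS]mulrA ler_wpM2l //.
  by rewrite mulr_ge0 ?expR_ge0 // ltW // hedge_pot_gt0.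
apply: le_trans (expR_ge1Dx _).
have -> : 1 + 2 * eta ^+ 2 * L ^+ 2 * w =
    \sum_j hedge h j * (1 + x j + 2 * eta ^+ 2 * L ^+ 2 * w).
  under eq_bigr do rewrite -addrA (addrC (x _)) addrA mulrDr.
  rewrite big_split /= -mulr_suml h1 mul1r.
  suff -> : \sum_j hedge h j * x j = 0 by rewrite addr0.
  under eq_bigr do rewrite /x mulrCA mulrBr.
  by rewrite -mulr_sumr big_split /= sumrN -mulr_suml h1 mul1r subrr mulr0.
apply: ler_sum => j _; rewrite ler_wpM2l //.
apply: le_trans (expR_quad_bound _) _.
  exact: le_trans (xb j) (le_trans etaw etaL).
rewrite lerD2l -!mulrA ler_wpM2l // -real_normK ?num_real //.
apply: (@le_trans _ _ ((eta * w * L) ^+ 2)).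
  by rewrite ler_pXn2r ?nnegrE ?normr_ge0 ?mulr_ge0.
have -> : (eta * w * L) ^+ 2 = eta ^+ 2 * (L ^+ 2 * (w * w)) by ring.
rewrite [leRHS](_ : _ = eta ^+ 2 * (L ^+ 2 * w)); last by ring.
by apply: ler_wpM2l; rewrite ?sqr_ge0 //; apply: ler_wpM2l; rewrite ?sqr_ge0 ?ler_piMr.
Qed.

(** The final potential is at least its j-th summand and at most the product of the one-step
    factors; taking logarithms and dividing by [eta] gives the bound. *)
Lemma hedge_regret_point (w : nat -> R) (ell : nat -> vec d -> R) T j :
  0 < eta -> 0 <= L -> eta * L <= 1 / 2 -> (forall t, 0 <= w t <= 1) ->
  (forall t j k, `|ell t (p j) - ell t (p k)| <= L) ->
  \sum_(t < T) w t * \sum_k hedge (mkseq (fun s => (w s, ell s)) t) k * ell t (p k)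
    <= \sum_(t < T) w t * ell t (p j)
       + (ln N.+1%:R / eta + 2 * eta * L ^+ 2 * \sum_(t < T) w t).
Proof.
move=> eta0 L0 etaL w01 lL; pose h t := mkseq (fun s => (w s, ell s)) t.
have pot : hedge_pot (h T) <= N.+1%:R * expR (\sum_(t < T) (- eta * (w t *
    \sum_k hedge (h t) k * ell t (p k)) + 2 * eta ^+ 2 * L ^+ 2 * w t)).
  elim: T => [|T IH].
    rewrite big_ord0 exp.expR0 mulr1 /hedge_pot.
    under eq_bigr do rewrite /cum_loss big_nil mulr0 exp.expR0.
    by rewrite sumr_const card_ord.
  rewrite big_ord_recr /= exp.expRD mulrA {1}/h mkseqS.
  apply: le_trans (hedge_pot_step _ (ltW eta0) L0 etaL (lL T) (w01 T)) _.
  by rewrite ler_wpM2r ?expR_ge0.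
have cumE : cum_loss (h T) j = \sum_(t < T) w t * ell t (p j).
  by rewrite /cum_loss big_map -(big_mkord xpredT (fun t => w t * ell t (p j)))
    /index_iota subn0.
have : expR (- eta * cum_loss (h T) j) <= hedge_pot (h T).
  rewrite /hedge_pot (bigD1 j) //= lerDl.
  by apply: sumr_ge0 => k _; exact: expR_ge0.
move=> /le_trans/(_ pot); rewrite -{1}[N.+1%:R]lnK ?posrE ?ltr0n // -exp.expRD ler_expR.
rewrite big_split /= -!mulr_sumr cumE -/h.
move: (\sum_(t < T) w t * ell t (p j)) (\sum_(t < T) w t * _) (\sum_(t < T) w t).
move: (ln _) => a b c W H.
rewrite -(ler_pM2l eta0) !mulrDr (mulrC _ (a / eta)) mulfVK ?gt_eqF //.
by move: H; rewrite (_ : 2 * eta ^+ 2 * L ^+ 2 * W = eta * (2 * eta * L ^+ 2 * W));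
  [lra | ring].
Qed.

End Hedge.

(** Averaging the bounds against single points with the weights that round [y] gives regret against
    [y] itself, at an extra [e] per unit of weight. *)
Lemma hedge_weighted_regret d N (K : set (vec d)) P (p : 'I_N.+1 -> vec d) T L eta e :
  0 < eta -> 0 <= L -> eta * L <= 1 / 2 ->
  (forall l, P l -> forall j k, `|l (p j) - l (p k)| <= L) ->
  roundable K P p e ->
  weighted_regret K P p T (ln N.+1%:R / eta) (2 * eta * L ^+ 2 + e).
Proof.
move=> eta0 L0 etaL PL rnd; exists (hedge p eta); split=> [h|]; first exact: hedge_simplex.
move=> w ell y w01 Pell /rnd[lam [[lam0 lam1] lamP]].
under eq_bigr do rewrite mulrBr.
rewrite big_split /= sumrN lerBlDr.
set S := \sum_(t < T) _.
have mix j : lam j * S <= lam j * (\sum_(t < T) w t * ell t (p j)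
       + (ln N.+1%:R / eta + 2 * eta * L ^+ 2 * \sum_(t < T) w t)).
  rewrite ler_wpM2l //; apply: hedge_regret_point => // t j' k.
  exact: PL.
have -> : S = \sum_j lam j * S by rewrite -mulr_suml lam1 mul1r.
apply: le_trans (ler_sum _ (fun j _ => mix j)) _.
under [leLHS]eq_bigr do rewrite mulrDr.
rewrite big_split /= -mulr_suml lam1 mul1r addrC (mulrDl (_ * L ^+ 2)) -!addrA.
rewrite lerD2l lerD2l.
under eq_bigr do rewrite mulr_sumr.
rewrite exchange_big /= mulr_sumr -big_split /=; apply: ler_sum => t _.
under eq_bigr do rewrite mulrCA.
rewrite -mulr_sumr (mulrC e) -mulrDr ler_wpM2l ?(andP (w01 t)).1 //.
by rewrite addrC lamP.
Qed.

(** * Small steps, continuity and attained minima *)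

Lemma le0_of_small_multiples (a b : R) :
  (forall t, 0 < t -> t <= 1 -> a <= t * b) -> a <= 0.
Proof.
move=> ab; rewrite leNgt; apply/negP => a0.
have b1 := ab 1 ltr01 (lexx _); rewrite mul1r in b1.
have b0 : 0 < b by exact: lt_le_trans a0 b1.
(* This value of t is at most 1 because a <= b, and it would force a <= a / 2. *)
have := ab (a / (2 * b)); rewrite divr_gt0 ?mulr_gt0 // => /(_ isT).
rewrite ler_pdivrMr ?mulr_gt0 // mul1r => /(_ ltac:(lra)).
rewrite (_ : a / (2 * b) * b = a / 2); last by field; rewrite gt_eqF.
lra.
Qed.

Lemma dot_continuous (F : realType) (T : topologicalType) d (f g : T -> 'rV[F]_d) :
  continuous f -> continuous g ->
  continuous (fun t => \sum_(i < d) f t ord0 i * g t ord0 i).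
Proof.
move=> cf cg; apply: continuous_big => [|i _ t].
  by move=> x; apply: cvgD; [exact: cvg_fst|exact: cvg_snd].
apply: cvgM.
  exact: (cvg_comp _ _ (cf t) (@coord_continuous _ _ _ ord0 i (f t))).
exact: (cvg_comp _ _ (cg t) (@coord_continuous _ _ _ ord0 i (g t))).
Qed.

Lemma edot_continuous (T : topologicalType) d (f g : T -> vec d) :
  continuous f -> continuous g -> continuous (fun t => edot (f t) (g t)).
Proof. exact: dot_continuous. Qed.

Lemma subr_cst_continuous (F : realType) d (c : 'rV[F]_d) :
  continuous (fun y : 'rV[F]_d => y - c).
Proof. by move=> y; apply: continuousB; [move=> A; exact|exact: cst_continuous]. Qed.

Lemma edotB_continuous d (c : vec d) :
  continuous (fun y : vec d => edot (y - c) (y - c)).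
Proof. by apply: edot_continuous; exact: subr_cst_continuous. Qed.

Lemma within_continuous_modulus (F : realType) (T : topologicalType) (K : set T)
    (l : T -> F) (g : T -> T -> F) :
  (forall x, K x -> g x x = 0 /\ {for x, continuous (g x)}) ->
  (forall x y, K x -> K y -> `|l x - l y| <= g x y) ->
  {within K, continuous l}.
Proof.
move=> gK lg; apply/subspace_continuousP => x Kx; apply/cvgrPdist_le => e e0.
have [gx0 cg] := gK x Kx.
move/cvgrPdist_le : cg => /(_ e e0) nearx; rewrite near_withinE.
apply: filterS nearx => t tx Kt; apply: le_trans (lg _ _ Kx Kt) _.
by move: tx; rewrite gx0 sub0r normrN; apply: le_trans; exact: ler_norm.
Qed.

Lemma scale_sqrt_continuous (F : realType) (T : topologicalType) (L : F) (f : T -> F) :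
  continuous f -> continuous (fun t => L * Num.sqrt (f t)).
Proof.
move=> cf t; apply: cvgM; first exact: cvg_cst.
exact: (cvg_comp _ _ (cf t) (@sqrt_continuous F (f t))).
Qed.

Lemma within_continuous_addZ (F : realType) (T : topologicalType) (K : set T)
    (l : T -> F) (c : F) (q : T -> F) :
  {within K, continuous l} -> continuous q ->
  {within K, continuous (fun y => l y + c * q y)}.
Proof.
move=> cl cq y; apply: cvgD; first exact: cl.
apply: cvgM; first exact: cvg_cst.
exact: (continuous_subspaceT cq).
Qed.

Lemma within_continuous_lipschitz d (K : set (vec d)) L l :
  loss_lipschitz K L l -> {within K, continuous l}.
Proof.
move=> lip; apply: (@within_continuous_modulus R _ K l (fun x y => L * enorm (y - x))).
  move=> x Kx; split; first by rewrite subrr /enorm edot0l sqrtr0 mulr0.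
  exact: (@scale_sqrt_continuous _ _ L _ (@edotB_continuous d x)).
by move=> x y Kx Ky; rewrite enormB; exact: lip.
Qed.

Lemma lipschitz_argmin d (K : set (vec d)) L l :
  compact K -> K !=set0 -> loss_lipschitz K L l ->
  exists2 z, K z & forall y, K y -> l z <= l y.
Proof.
move=> cK K0 /within_continuous_lipschitz cl.
have [z Kz zmin] := compact_EVT_min K0 cK cl.
by exists z => [|y Ky]; [rewrite inE in Kz|apply: zmin; rewrite inE].
Qed.

(** * Strong convexity through proximal points *)

Section StrongConvexity.
Context (d : nat) (K : set (vec d)) (L alpha : R) (l : vec d -> R).
Hypotheses (cK : compact K) (convK : convex_setE K) (alpha0 : 0 < alpha).
Hypotheses (lipl : loss_lipschitz K L l) (scl : loss_strongly_convex K alpha l).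

(* The first-order condition at the proximal point z of m says that
   2c(m - z) is a subgradient at z. *)
Lemma prox_subgradient (m : vec d) (c : R) : K m -> 0 < c ->
  exists2 z, K z & is_subgradient K l z ((2 * c) *: (m - z)).
Proof.
move=> Km c0.
have cf : {within K, continuous (fun y => l y + c * edot (y - m) (y - m))}.
  exact: (@within_continuous_addZ R _ K _ c _ (within_continuous_lipschitz lipl)
    (@edotB_continuous d m)).
have [z Kz zmin] := compact_EVT_min (ex_intro K m Km) cK cf.
rewrite inE in Kz; exists z => // y Ky; rewrite edotZl -subr_le0.
apply: (@le0_of_small_multiples _ (c * edot (y - z) (y - z))) => t t0 t1.
have Kt : K (t *: y + (1 - t) *: z) by apply: convK => //; exact: ltW.
have := zmin _ (mem_set Kt); have := scl.1 y z t Ky Kz (ltW t0) t1.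
rewrite (_ : t *: y + (1 - t) *: z - m = t *: (y - z) + (z - m)); last first.
  by apply/rowP => i; rewrite !mxE; ring.
rewrite -(opprB z m) edotNl.
move: (l (t *: y + _)) => lt; move: (y - z) (z - m) => u v.
rewrite !edotE (edotC u v).
move: (edot v v) (edot v u) (edot u u) => A B C.
move=> h1 h2; rewrite -(ler_pM2l t0); lra.
Qed.

(* The strong convexity hypothesis only speaks about points that have a
   subgradient; it is used at proximal points, which converge to m. *)
Lemma strongly_convex_midpoint x y : K x -> K y ->
  l ((1 / 2) *: x + (1 - 1 / 2) *: y) <=
    (l x + l y) / 2 - alpha / 8 * edot (x - y) (x - y).
Proof.
move=> Kx Ky; set m := _ + _.
have Km : K m by apply: convK => //; lra.
rewrite -subr_le0; apply: (@le0_of_small_multiples _ (L ^+ 2)) => t t0 _.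
have c0 : 0 < (2 * t)^-1 by rewrite invr_gt0 mulr_gt0.
(* With c = 1/(2t), the subgradient inequality towards m and the Lipschitz bound give 2c|m - z|^2 <=
   L|m - z|. Hence |m - z| <= tL, and replacing l(m) by l(z) costs at most tL^2. *)
have [z Kz] := prox_subgradient Km c0; set c := (2 * t)^-1 in c0 * => zsub.
have ct : 2 * c * t = 1 by rewrite /c; field; rewrite gt_eqF.
have hm := zsub m Km.
have lipm : l m - l z <= L * enorm (m - z).
  by apply: le_trans (lipl Km Kz); exact: ler_norm.
have lm : l m - l z <= t * L ^+ 2.
  move: hm lipm (enorm_ge0 (m - z)); rewrite edotZl -enorm_sqr.
  move: (enorm (m - z)) => a h1 h2 a0.
  have h3 : 2 * c * a ^+ 2 <= L * a by lra.
  have [a00|an0] := eqVneq a 0.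
    by rewrite a00 mulr0 in h2; apply: le_trans h2 _; rewrite mulr_ge0 ?sqr_ge0 // ltW.
  have ap : 0 < a by rewrite lt_def an0.
  have h4 : 2 * c * a <= L by rewrite -(ler_pM2r ap); lra.
  have h5 : a <= t * L.
    rewrite -[a]mul1r -ct (mulrC _ t) -mulrA ler_pM2l //.
  apply: le_trans h2 _; rewrite expr2 mulrCA ler_wpM2l //.
  by apply: le_trans h4; rewrite !mulr_ge0 // ltW.
(* Average strong convexity at z towards x and y. The subgradient terms add up to a nonnegative
   multiple of |m - z|^2, and |x - z|^2 + |y - z|^2 >= |x - y|^2 / 2. *)
have := scl.2 z x _ Kz Kx zsub; have := scl.2 z y _ Kz Ky zsub.
rewrite !edotZl !enorm_sqr => hy hx.
have e1 : m - z = (1 / 2) *: ((x - z) + (y - z)).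
  by apply/rowP => i; rewrite !mxE; field.
have e2 : x - y = (x - z) - (y - z).
  by rewrite opprB addrA subrK.
move: hx hy (edot_ge0 (x - z + (y - z))); rewrite e2 e1.
move: (x - z) (y - z) => u v; rewrite !edotE (edotC v u).
move: (edot u u) (edot u v) (edot v v) => A B C hx hy h0.
have h6 : 0 <= alpha * (A + B + (B + C)) by rewrite mulr_ge0 // ltW.
have h7 : 0 <= c * (A + B + (B + C)) by rewrite mulr_ge0 // ltW.
lra.
Qed.

End StrongConvexity.

(** * Follow-the-leader for weighted strongly convex losses *)

Lemma sqr_over_sum_le_ln (W w : R) : 0 <= W -> 0 <= w <= 1 ->
  w ^+ 2 / (W + w) <= 2 * (ln (1 + (W + w)) - ln (1 + W)).
Proof.
move=> W0 /andP[w0 w1].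
have p1 : 0 < 1 + W by lra.
have p2 : 0 < 1 + (W + w) by lra.
have lnle : w / (1 + (W + w)) <= ln (1 + (W + w)) - ln (1 + W).
  have : ln (1 + (- (w / (1 + (W + w))))) <= - (w / (1 + (W + w))).
    apply: le_ln1Dx; rewrite ltrN2 ltr_pdivrMr // mul1r; lra.
  rewrite (_ : 1 + - (w / (1 + (W + w))) = (1 + W) / (1 + (W + w))); last first.
    by field; rewrite gt_eqF.
  rewrite ln_div ?posrE //; lra.
(* With S = W + w there remains w(1 + S) <= 2S, true because w <= S and w <= 1. The 1 inside the
   logarithm keeps the first increment finite when W = 0. *)
apply: le_trans (ler_wpM2l _ lnle) => //; rewrite mulrA.
have [->|wn0] := eqVneq w 0; first by rewrite expr0n mul0r mulr0 mul0r.
have wp : 0 < w by rewrite lt_def wn0.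
rewrite ler_pdivrMr ?ltr_wpDl // mulrAC ler_pdivlMr //.
have : 0 <= w * (W + w - w) by rewrite addrK mulr_ge0.
have : 0 <= w * (1 - w) by rewrite mulr_ge0 // subr_ge0.
have : 0 <= w * W * (1 - w) by rewrite !mulr_ge0 // subr_ge0.
have : 0 <= w * w * (1 - w) by rewrite !mulr_ge0 // subr_ge0.
nra.
Qed.

Section FollowTheLeader.
Context (d : nat) (K : set (vec d)) (L alpha : R).
Hypotheses (cK : compact K) (convK : convex_setE K) (K0 : K !=set0).
Hypotheses (L0 : 0 <= L) (alpha0 : 0 < alpha).

Section Analysis.
Context (w : nat -> R) (ell : nat -> vec d -> R) (z : nat -> vec d).
Let G t y : R := \sum_(s < t) w s * ell s y.
Let W t : R := \sum_(s < t) w s.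
Hypotheses (w01 : forall t, 0 <= w t <= 1).
Hypotheses (lip : forall t, loss_lipschitz K L (ell t)).
Hypotheses (sc : forall t, loss_strongly_convex K alpha (ell t)).
Hypotheses (Kz : forall t, K (z t)) (zmin : forall t y, K y -> G t (z t) <= G t y).

Let W_ge0 t : 0 <= W t.
Proof. by apply: sumr_ge0 => s _; case/andP: (w01 s). Qed.

(** The midpoint of [y] and the leader cannot beat the leader, so the summed midpoint inequality
    turns its quadratic gain into growth away from the minimum. *)
Lemma leader_growth t y : K y ->
  alpha / 4 * W t * edot (y - z t) (y - z t) <= G t y - G t (z t).
Proof.
move=> Ky; set m := (1 / 2) *: y + (1 - 1 / 2) *: z t.
have Km : K m by apply: convK => //; lra.
have : G t m <= (G t y + G t (z t)) / 2
                - alpha / 8 * W t * edot (y - z t) (y - z t).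
  have mid s := strongly_convex_midpoint cK convK alpha0 (lip s) (sc s) Ky (Kz t).
  move: (edot _ _) mid => Q mid.
  have -> : (G t y + G t (z t)) / 2 - alpha / 8 * W t * Q = \sum_(s < t)
      ((w s * ell s y + w s * ell s (z t)) / 2 - alpha / 8 * w s * Q).
    by rewrite sumrB -!mulr_suml -mulr_sumr big_split.
  apply: ler_sum => s _; have /andP[ws0 _] := w01 s.
  have := ler_wpM2l ws0 (mid s); move=> /le_trans; apply.
  by rewrite le_eqVlt; apply/orP; left; apply/eqP => /=; field.
have := zmin t Km; lra.
Qed.

(** Growth at time t+1 against the Lipschitz bound shows that the leader moves by at most 4 L w_t /
    (alpha W_{t+1}). The change therefore costs at most (4 L^2 / alpha) w_t^2 / W_{t+1}, which a
    logarithmic increment dominates, and these increments telescope. *)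
Lemma leader_step t :
  w t * (ell t (z t) - ell t (z t.+1)) <=
  8 * L ^+ 2 / alpha * (ln (1 + W t.+1) - ln (1 + W t)).
Proof.
have /andP[wt0 wt1] := w01 t.
have GS y : G t.+1 y = G t y + w t * ell t y by rewrite /G big_ord_recr.
have WS : W t.+1 = W t + w t by rewrite /W big_ord_recr.
have := leader_growth t.+1 (Kz t); have := zmin t (Kz t.+1).
rewrite !GS WS -enorm_sqr => h1 h2.
have h3 : alpha / 4 * (W t + w t) * enorm (z t - z t.+1) ^+ 2 <=
    w t * (ell t (z t) - ell t (z t.+1)) by lra.
have h4 : w t * (ell t (z t) - ell t (z t.+1)) <= w t * (L * enorm (z t - z t.+1)).
  by rewrite ler_wpM2l // (le_trans (ler_norm _)) // lip.
have h34 := le_trans h3 h4.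
have lnle := sqr_over_sum_le_ln (W_ge0 t) (w01 t).
apply: (@le_trans _ _ (4 * L ^+ 2 / alpha * (w t ^+ 2 / (W t + w t)))); last first.
  rewrite (_ : 8 * L ^+ 2 / alpha * (ln (1 + (W t + w t)) - ln (1 + W t)) =
    4 * L ^+ 2 / alpha * (2 * (ln (1 + (W t + w t)) - ln (1 + W t)))); last by ring.
  by rewrite ler_wpM2l // divr_ge0 ?mulr_ge0 ?sqr_ge0 // ltW.
apply: le_trans h4 _.
move: h34 (enorm_ge0 (z t - z t.+1)); move: (enorm _) => a h34 a0.
have [->|wn0] := eqVneq (w t) 0; first by rewrite !(mul0r, expr0n, mulr0).
have wp : 0 < w t by rewrite lt_def wn0.
have Wp : 0 < W t + w t by rewrite ltr_wpDl.
have [->|an0] := eqVneq a 0.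
  by rewrite !mulr0 !mulr_ge0 ?invr_ge0 ?sqr_ge0 // ltW.
have ap : 0 < a by rewrite lt_def an0.
have h5 : alpha / 4 * (W t + w t) * a <= w t * L.
  by rewrite -(ler_pM2r ap); lra.
rewrite (_ : 4 * L ^+ 2 / alpha * (w t ^+ 2 / (W t + w t)) =
  w t * (L * (w t * L / (alpha / 4 * (W t + w t))))); last first.
  by field; rewrite ?gt_eqF.
rewrite !ler_wpM2l // ler_pdivlMr ?mulr_gt0 ?divr_gt0 //.
by rewrite mulrC.
Qed.

(** By induction: the bound for the first T rounds is applied at the leader of round T+1, which then
    beats every [y]. *)
Lemma be_the_leader T y : K y -> \sum_(t < T) w t * ell t (z t.+1) <= G T y.
Proof.
elim: T y => [|T IH] y Ky; first by rewrite /G !big_ord0.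
rewrite big_ord_recr /=; apply: le_trans (zmin T.+1 Ky).
by rewrite /G big_ord_recr lerD2r; exact: IH.
Qed.

Lemma leader_regret T y : K y ->
  \sum_(t < T) w t * (ell t (z t) - ell t y) <= 8 * L ^+ 2 / alpha * ln (1 + T%:R).
Proof.
move=> Ky; apply: (@le_trans _ _ (\sum_(t < T) w t * (ell t (z t) - ell t (z t.+1)))).
  rewrite -subr_ge0 -sumrB.
  under eq_bigr do rewrite -mulrBr opprB addrC addrA subrK mulrBr.
  by rewrite sumrB subr_ge0 be_the_leader.
apply: (@le_trans _ _ (8 * L ^+ 2 / alpha * ln (1 + W T))).
  elim: T => [|T IH]; first by rewrite /W !big_ord0 addr0 ln1 mulr0.
  rewrite big_ord_recr /=; apply: le_trans (lerD IH (leader_step T)) _.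
  by rewrite mulrBr addrC subrK.
rewrite ler_wpM2l //; first by rewrite divr_ge0 ?mulr_ge0 ?sqr_ge0 // ltW.
have WT : W T <= T%:R.
  apply: (@le_trans _ _ (\sum_(t < T) 1)); last by rewrite sumr_const card_ord.
  by apply: ler_sum => s _; case/andP: (w01 s).
have W0 := W_ge0 T.
by rewrite ler_ln ?posrE ?lerD2l //; lra.
Qed.

End Analysis.

Lemma ftl_weighted_regret N (P : (vec d -> R) -> Prop) (p : 'I_N -> vec d) T e :
  (forall l, P l -> loss_lipschitz K L l) ->
  (forall l, P l -> loss_strongly_convex K alpha l) ->
  roundable K P p e ->
  weighted_regret K P p T (8 * L ^+ 2 / alpha * ln (1 + T%:R)) e.
Proof.
move=> Plip Psc rnd.
pose F (h : seq (R * (vec d -> R))) y : R := \sum_(e <- h) e.1 * e.2 y.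
(* The algorithm must answer on every history, even one whose cumulative loss has no minimizer in K;
   there it takes an arbitrary point of K. *)
have lead_ex h : exists z, K z /\
    ((exists2 z, K z & forall y, K y -> F h z <= F h y) ->
      forall y, K y -> F h z <= F h y).
  have [[z Kz zmin]|nz] := pselect (exists2 z, K z & forall y, K y -> F h z <= F h y).
    by exists z.
  by have [z Kz] := K0; exists z; split.
pose lead h := sval (cid (lead_ex h)).
have Klead h : K (lead h) by rewrite /lead; case: cid => z [].
have leadP h : (exists2 z, K z & forall y, K y -> F h z <= F h y) ->
    forall y, K y -> F h (lead h) <= F h y by rewrite /lead; case: cid => z [].
exists (fun h => sval (cid (rnd _ (Klead h)))); split=> [h|w ell y w01 Pell Ky].
  by case: cid => lam [].
pose h t := mkseq (fun s => (w s, ell s)) t.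
have FE t x : F (h t) x = \sum_(s < t) w s * ell s x.
  by rewrite /F big_map -(big_mkord xpredT (fun s => w s * ell s x)) /index_iota subn0.
have zmin t x : K x -> \sum_(s < t) w s * ell s (lead (h t)) <= \sum_(s < t) w s * ell s x.
  rewrite -!FE; apply: leadP.
  (* On the histories that matter the cumulative loss is Lipschitz with constant L times the total
     weight, so its minimum is attained. *)
  apply: (@lipschitz_argmin _ _ ((\sum_(s < t) w s) * L)) => // x1 x2 Kx1 Kx2.
  rewrite !FE -sumrB -mulrA mulr_suml; apply: le_trans (ler_norm_sum _ _ _) _.
  apply: ler_sum => s _; have /andP[ws0 _] := w01 s.
  by rewrite -mulrBr normrM ger0_norm // ler_wpM2l // (Plip _ (Pell s)).
have := leader_regret w01 (fun t => Plip _ (Pell t)) (fun t => Psc _ (Pell t))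
  (fun t => Klead (h t)) zmin T Ky.
move=> reg; apply: le_trans (lerD reg (lexx _)).
rewrite mulr_sumr -big_split /=; apply: ler_sum => t _.
rewrite (mulrC e) -mulrDr ler_wpM2l ?(andP (w01 t)).1 //.
case: cid => lam /= [_ /(_ _ (Pell t))].
rewrite -/(h t); lra.
Qed.

End FollowTheLeader.

(** * Projections onto compact convex sets and hulls *)

Section Projection.
Context (n : nat) (M : set (vec n)).
Hypotheses (cM : compact M) (M0 : M !=set0).

Lemma projection_exists (q : vec n) :
  exists2 x, M x & forall y, M y -> edot (x - q) (x - q) <= edot (y - q) (y - q).
Proof.
have [x Mx xmin] := compact_EVT_min M0 cM
  (continuous_subspaceT (@edotB_continuous n q)).
by exists x => [|y My]; [rewrite inE in Mx|apply: xmin; rewrite inE].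
Qed.

Lemma linear_argmax (v : vec n) :
  exists2 x, M x & forall y, M y -> edot y v <= edot x v.
Proof.
have cv : continuous (fun y : vec n => edot y v).
  by apply: edot_continuous => y; [move=> A; exact|exact: cst_continuous].
have [x Mx xmax] := compact_EVT_max M0 cM (continuous_subspaceT cv).
by exists x => [|y My]; [rewrite inE in Mx|apply: xmax; rewrite inE].
Qed.

(** Moving from [x] towards [y] by a small step t cannot decrease the distance to [q]; divide by t
    and let it tend to 0. *)
Lemma projection_obtuse (q x : vec n) : convex_setE M -> M x ->
  (forall y, M y -> edot (x - q) (x - q) <= edot (y - q) (y - q)) ->
  forall y, M y -> edot (y - x) (q - x) <= 0.
Proof.
move=> convM Mx xmin y My.
suff : 2 * edot (y - x) (q - x) <= 0 by rewrite pmulr_rle0.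
apply: (@le0_of_small_multiples _ (edot (y - x) (y - x))) => t t0 t1.
have Mt : M (t *: y + (1 - t) *: x) by apply: convM => //; exact: ltW.
have := xmin _ Mt.
rewrite (_ : t *: y + (1 - t) *: x - q = t *: (y - x) - (q - x)); last first.
  by apply/rowP => i; rewrite !mxE; ring.
rewrite -(opprB q x); move: (y - x) (q - x) => u v.
rewrite !edotE (edotC v u).
move: (edot u u) (edot u v) (edot v v) => A B C h.
rewrite -(ler_pM2l t0); lra.
Qed.

End Projection.

Lemma simplex_compact (F : realType) N :
  compact [set v : 'rV[F]_N | (forall j, 0 <= v ord0 j <= 1) /\ \sum_j v ord0 j = 1].
Proof.
have cube : compact [set v : 'rV[F]_N | forall j, `[0, 1]%classic (v ord0 j)].
  by apply: (@rV_compact F N (fun=> `[0, 1]%classic)) => j; exact: segment_compact.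
have csum : continuous (fun v : 'rV[F]_N => \sum_j v ord0 j).
  apply: continuous_big => [x|j _]; first by apply: cvgD; [exact: cvg_fst|exact: cvg_snd].
  exact: coord_continuous.
have cl1 : closed [set v : 'rV[F]_N | \sum_j v ord0 j = 1].
  apply: (@closed_comp _ _ (fun v : 'rV[F]_N => \sum_j v ord0 j) [set 1]).
    by move=> x _; exact: csum.
  exact: closed_eq.
exact: compact_closedI cube cl1.
Qed.

Lemma comb_continuous (F : realType) N n (p : 'I_N -> 'rV[F]_n) :
  continuous (fun v : 'rV[F]_N => \sum_j v ord0 j *: p j).
Proof.
apply: continuous_big => [x|j _ v]; first by apply: cvgD; [exact: cvg_fst|exact: cvg_snd].
have h : (w : 'rV[F]_N) ord0 j @[w --> v] --> v ord0 j by exact: coord_continuous.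
exact: cvgZr_tmp h.
Qed.

(** The hull is the image of the compact simplex under a continuous map, so [y] has a nearest point
    in it; the inequalities are the obtuse-angle condition there, tested at the vertices. *)
Lemma hull_projection N n (p : 'I_N.+1 -> vec n) (y : vec n) :
  exists lam, simplex lam /\ forall k,
    edot (p k - \sum_j lam j *: p j) (y - \sum_j lam j *: p j) <= 0.
Proof.
pose S := [set v : 'rV[R]_N.+1 | (forall j, 0 <= v ord0 j <= 1) /\ \sum_j v ord0 j = 1].
pose f (v : 'rV[R]_N.+1) : vec n := \sum_j v ord0 j *: p j.
have simplexS lam : simplex lam -> S (\row_j lam j).
  move=> sl; split=> [j|]; first by rewrite mxE sl.1 simplex_le1.
  by under eq_bigr do rewrite mxE; exact: sl.2.
have fS lam : f (\row_j lam j) = \sum_j lam j *: p j.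
  by apply: eq_bigr => j _; rewrite mxE.
have fp k : f (\row_j (j == k)%:R) = p k.
  rewrite fS (bigD1 k) //= eqxx scale1r big1 ?addr0 // => j /negPf ->.
  by rewrite scale0r.
have cM : compact (f @` S).
  apply: continuous_compact; last exact: simplex_compact.
  exact/continuous_subspaceT/comb_continuous.
have pM k : (f @` S) (p k).
  by exists (\row_j (j == k)%:R) => //; apply: simplexS; exact: simplex_delta.
have convM : convex_setE (f @` S).
  move=> _ _ t [u [u0 u1] <-] [v [v0 v1] <-] t0 t1.
  have t1' : 0 <= 1 - t by rewrite subr_ge0.
  exists (\row_j (t * u ord0 j + (1 - t) * v ord0 j)).
    apply: simplexS; split=> [j|].
      have /andP[uj _] := u0 j; have /andP[vj _] := v0 j.
      by rewrite addr_ge0 // mulr_ge0.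
    by rewrite big_split /= -!mulr_sumr u1 v1 !mulr1 addrC subrK.
  rewrite fS /f !scaler_sumr -big_split /=; apply: eq_bigr => j _.
  by rewrite !scalerA -scalerDl.
have M0 : f @` S !=set0 by exists (p ord0).
have [_ [v [v0 v1] <-] vmin] := projection_exists cM M0 y.
exists (fun j => v ord0 j); split; first by split=> // j; case/andP: (v0 j).
move=> k; rewrite -/(f v); apply: (projection_obtuse convM _ vmin) => //.
by exists v.
Qed.

(** * Polytope approximation from a grid on the surface of a cube *)

Lemma exit_point n (x v : vec n) (a b : R) : 0 <= a -> a <= b -> v != 0 ->
  (forall i, `|x ord0 i| <= a) ->
  exists (r : R) i, [/\ 0 <= r, b - a <= `|r * v ord0 i|,
    `|(x + r *: v) ord0 i| = b & forall j, `|(x + r *: v) ord0 j| <= b].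
Proof.
move=> a0 ab v0 xa.
have [i0 vi0] : exists i, v ord0 i != 0.
  apply/existsP; apply: contraNT v0 => /existsPn nv.
  by apply/eqP/rowP => i; rewrite mxE; apply/eqP; move: (nv i); rewrite negbK.
(* Time at which the ray from x along v reaches the face of coordinate i that it is heading for; the
   ray leaves the cube at the smallest of these times. *)
pose ex i := (b - Num.sg (v ord0 i) * x ord0 i) / `|v ord0 i|.
have sgx i : Num.sg (v ord0 i) * x ord0 i <= a.
  apply: le_trans (ler_norm _) _; rewrite normrM; apply: le_trans (xa i).
  by rewrite ler_piMl // normr_sg lern1 leq_b1.
case: (@arg_minP _ _ _ i0 (fun i => v ord0 i != 0) ex vi0) => i vi imin.
have r0 : 0 <= ex i.
  by rewrite divr_ge0 // subr_ge0; exact: le_trans (sgx i) ab.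
have hit : Num.sg (v ord0 i) * (x + ex i *: v) ord0 i = b.
  rewrite !mxE mulrDr mulrCA -normrEsg mulfVK ?normr_eq0 //.
  by rewrite addrC subrK.
have hitn : `|(x + ex i *: v) ord0 i| = b.
  have b0 : 0 <= b by exact: le_trans ab.
  by rewrite -(ger0_norm b0) -hit normrM normr_sg vi mul1r.
exists (ex i), i; split => // [|j].
  rewrite -hitn !mxE lerBlDr; apply: le_trans (ler_normD _ _) _.
  by rewrite addrC lerD2l.
have := xa j; rewrite !mxE !ler_norml => /andP[xj1 xj2].
have [vj0|vj0] := eqVneq (v ord0 j) 0; first by rewrite vj0; lra.
have := imin j vj0; rewrite {2}/ex ler_pdivlMr ?normr_gt0 //.
case: (ltgtP (v ord0 j) 0) vj0 => // vj _.
  rewrite ltr0_sg // ltr0_norm // mulrN mulN1r opprK.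
  have : ex i * v ord0 j <= 0 by rewrite mulr_ge0_le0 // ltW.
  lra.
rewrite gtr0_sg // gtr0_norm // mul1r.
have : 0 <= ex i * v ord0 j by rewrite mulr_ge0 // ltW.
lra.
Qed.

(** Grid on the surface of the cube [-3,3]^(n+1): the index and the boolean select a face ([true] is
    the negative side), and the function selects one of m+1 equally spaced values in each other
    coordinate. *)
Definition grid n m (e : 'I_n.+1 * bool * {ffun 'I_n -> 'I_m.+1}) : vec n.+1 :=
  \row_k if unlift e.1.1 k is Some k' then - 3 + 6 * (e.2 k')%:R / m%:R
         else (-1) ^+ e.1.2 * 3.

Lemma grid_net n m (q : vec n.+1) i : (0 < m)%N ->
  `|q ord0 i| = 3 -> (forall j, `|q ord0 j| <= 3) ->
  exists e : 'I_n.+1 * bool * {ffun 'I_n -> 'I_m.+1},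
    edot (q - grid e) (q - grid e) <= n%:R * (6 / m%:R) ^+ 2.
Proof.
move=> m0 qi qj; have mR : 0 < m%:R :> R by rewrite ltr0n.
pose c k : R := (q ord0 (lift i k) + 3) * m%:R / 6.
have cb k : 0 <= c k <= m%:R.
  have := qj (lift i k); rewrite ler_norml => /andP[h1 h2].
  have h0 : 0 <= q ord0 (lift i k) + 3 by lra.
  rewrite /c divr_ge0 ?mulr_ge0 //=.
  by rewrite ler_pdivrMr // mulrC ler_pM2l //; lra.
have ck k : (Num.trunc (c k) < m.+1)%N.
  have /andP[c0 cm] := cb k.
  rewrite ltnS -(ler_nat R); apply: le_trans cm.
  by case/andP: (truncn_itv c0).
exists (i, q ord0 i < 0, [ffun k => Ordinal (ck k)]).
rewrite /edot (bigD1_ord i) //= !mxE unlift_none /=.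
have -> : q ord0 i - (-1) ^+ (q ord0 i < 0)%R * 3 = 0.
  move: qi; case: ltP => q0; [rewrite ltr0_norm // expr1|rewrite ger0_norm // expr0]; lra.
rewrite mul0r add0r; apply: (@le_trans _ _ (\sum_(k < n) (6 / m%:R : R) ^+ 2)); last first.
  by rewrite sumr_const card_ord -[leLHS]mulr_natl.
apply: ler_sum => k _; rewrite !mxE liftK ffunE /= -expr2.
have /andP[c0 _] := cb k; have /andP[t1 t2] := truncn_itv c0.
have -> : q ord0 (lift i k) - (- 3 + 6 * (Num.trunc (c k))%:R / m%:R) =
    6 / m%:R * (c k - (Num.trunc (c k))%:R).
  by rewrite /c; field; rewrite gt_eqF.
rewrite exprMn ler_piMr ?sqr_ge0 // expr_le1 //; first by rewrite lerBlDr addrC natr1 ltW.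
by rewrite subr_ge0.
Qed.

(* The projections onto M of two points at distance eps differ, in the normal
   direction of the first, by O(eps^2); hence eps^-n points on a sphere around
   M yield a polytope at Hausdorff distance O(eps^2) (Bronshtein-Ivanov). *)
Lemma projection_normal_gap n (x p q g : vec n) :
  0 <= edot (x - p) (q - x) -> edot (x - p) (g - p) <= 0 ->
  2 * edot (x - p) (q - x) <= edot (q - g) (q - g).
Proof.
move=> h1 h2; have -> : q - g = (x - p) + ((q - x) - (g - p)).
  by apply/rowP => i; rewrite !mxE; ring.
have := edot_ge0 (x - p); have := edot_ge0 ((q - x) - (g - p)).
move: h1 h2; move: (x - p) (q - x) (g - p) => a b e.
rewrite [edot (a + _) _]edotDl !(edotDr _ a) (edotC (b - e) a) [edot a (b - e)]edotDr edotNr.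
move: (edot (b - e) _) => S; lra.
Qed.

(** Let z be the hull projection of y and v = y - z. Push the extreme point x of M in direction v
    out to the cube surface, at q = x + r v, and take a grid point g near q. The projection of g is
    a net point, so extremality of x and the obtuse angle at z give |v|^2 <= <x - pr g, v>, while
    the normal gap makes r times the right side O(s^-2). *)
Lemma convex_net n : exists C : R, 0 < C /\
  forall (M : set (vec n.+1)) c, compact M -> convex_setE M -> M !=set0 ->
  (forall x, M x -> edot (x - c) (x - c) <= 4) ->
  forall s : R, 1 <= s ->
  exists N (p : 'I_N.+1 -> vec n.+1),
    [/\ N.+1%:R <= C * s ^+ n, forall j, M (p j) &
      forall y, M y -> exists lam, simplex lam /\
        enorm (\sum_j lam j *: p j - y) <= (s ^+ 2)^-1].
Proof.
pose k : R := n.+1%:R; have k1 : 1 <= k by rewrite ler1n.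
(* There are 2k faces, and each free coordinate takes m+1 <= 6ks + 2 <= 8ks values. *)
exists (k * 2 * (8 * k) ^+ n); split; first by rewrite !mulr_gt0 ?exprn_gt0 ?mulr_gt0; lra.
move=> M c cM convM M0 Mc s s1; have s0 : 0 < s by lra.
(* The mesh 6/m is then at most 1/(ks), so the squared distance to the grid, at most n times its
   square, is below s^-2. *)
pose m := (Num.trunc (6 * k * s)).+1.
have ks1 : 1 <= k * s by rewrite mulr_ege1.
have [m1 m2] : (Num.trunc (6 * k * s))%:R <= 6 * k * s /\ 6 * k * s <= m%:R.
  have /truncn_itv/andP[h1 h2] : 0 <= 6 * k * s by lra.
  by split=> //; exact: ltW.
have mR : 0 < m%:R :> R by rewrite ltr0n.
have eps : n%:R * (6 / m%:R) ^+ 2 <= (s ^+ 2)^-1.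
  have h1 : 6 / m%:R <= (k * s)^-1.
    rewrite ler_pdivrMr // -[leRHS]mulrC ler_pdivlMr; lra.
  apply: (@le_trans _ _ (k * (k * s)^-1 ^+ 2)).
    apply: ler_pM; rewrite ?sqr_ge0 ?ler0n ?ler_nat //.
    by rewrite ler_pXn2r ?nnegrE ?divr_ge0 ?invr_ge0 ?mulr_ge0 //; lra.
  have -> : k * (k * s)^-1 ^+ 2 = (k * s ^+ 2)^-1.
    by field; rewrite !gt_eqF //; lra.
  have s2 : 0 < s ^+ 2 by rewrite exprn_gt0.
  by rewrite lef_pV2 ?posrE ?mulr_gt0 ?ler_peMl //; lra.
pose E := ('I_n.+1 * bool * {ffun 'I_n -> 'I_m.+1})%type.
have EC : #|{: E}| = (n.+1 * 2 * m.+1 ^ n)%N.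
  by rewrite !card_prod card_ord card_bool card_ffun !card_ord.
have [N EN] : exists N, #|{: E}| = N.+1.
  by exists #|{: E}|.-1; rewrite prednK // EC !muln_gt0 expn_gt0.
pose pr q := sval (cid2 (projection_exists cM M0 q)).
have prM q : M (pr q) by rewrite /pr; case: cid2.
have pr_min q y : M y -> edot (pr q - q) (pr q - q) <= edot (y - q) (y - q).
  by rewrite /pr; case: cid2 => x /= _; exact.
pose p j := pr (c + grid (enum_val (cast_ord (esym EN) j) : E)).
exists N, p; split=> [|j|y My]; [|exact: prM|].
  rewrite -EN EC !natrM natrX -(mulrA (k * 2)).
  apply: ler_wpM2l; first by rewrite mulr_ge0 ?ler0n.
  have [->|n0] := posnP n; first by rewrite !expr0 ?mulr1.
  rewrite -exprMn ler_pXn2r ?nnegrE ?mulr_ge0 ?ler0n //; try lra.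
  rewrite -natr1 /m -natr1; lra.
have [lam [lamS obt]] := hull_projection p y.
exists lam; split=> //; set z := \sum_j _ in obt *.
rewrite enormB; set v := y - z.
have [v0|vN0] := eqVneq v 0.
  by rewrite v0 /enorm edot0l sqrtr0 invr_ge0 sqr_ge0.
have [x Mx xmax] := linear_argmax cM M0 v.
have xc2 i : `|(x - c) ord0 i| <= 2.
  rewrite -(@ler_pXn2r _ 2) ?nnegrE // real_normK ?num_real //.
  by apply: le_trans (sqr_coord_le _ _) _; apply: le_trans (Mc _ Mx) _; lra.
have [|//|r [i [r0 ri hit hits]]] := @exit_point _ (x - c) v 2 3 _ _ vN0 xc2; try lra.
have [e he] := grid_net (m := m) isT hit hits.
pose g := c + grid e; pose q := x + r *: v.
have qg : edot (q - g) (q - g) <= (s ^+ 2)^-1.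
  apply: le_trans eps; apply: le_trans he; rewrite le_eqVlt; apply/orP; left.
  suff -> : q - g = x - c + r *: v - grid e by [].
  by rewrite /q /g opprD addrA [x + _ - c]addrAC.
have xpv : 0 <= edot (x - pr g) v.
  by rewrite edotDl edotNl subr_ge0; exact/xmax/prM.
have gap : 2 * (r * edot (x - pr g) v) <= (s ^+ 2)^-1.
  apply: le_trans qg; rewrite -edotZr.
  have -> : r *: v = q - x by rewrite /q addrC addKr.
  apply: projection_normal_gap.
    by rewrite /q addrAC subrr add0r edotZr mulr_ge0.
  exact: (projection_obtuse convM (prM g) (pr_min g)).
have pz : edot (pr g - z) v <= 0.
  have := obt (cast_ord EN (enum_rank e)).
  by rewrite /p cast_ordK enum_rankK.
have vv : edot v v <= edot (x - pr g) v.
  have := xmax y My; move: pz; rewrite {2 4}/v !edotE.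
  lra.
(* The ray runs from the cube of half-side 2 to the surface of the one of half-side 3, so some
   coordinate of r v is at least 1 in absolute value. This turns the bound on r|v|^2 into one on
   |v|. *)
have rv : 1 <= r * enorm v.
  have h : enorm (r *: v) = r * enorm v.
    rewrite /enorm edotZl edotZr mulrA -expr2 sqrtrM ?sqr_ge0 //.
    by rewrite sqrtr_sqr ger0_norm.
  rewrite -h -(@ler_pXn2r _ 2) ?nnegrE ?enorm_ge0 // enorm_sqr expr1n.
  apply: le_trans (sqr_coord_le _ i); rewrite mxE -real_normK ?num_real //.
  by rewrite -(expr1n _ 2) ler_pXn2r ?nnegrE //; lra.
have a0 := enorm_ge0 v; move: vv; rewrite -enorm_sqr => vv.
apply: le_trans gap; apply: (@le_trans _ _ (2 * (r * enorm v ^+ 2))); last first.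
  by rewrite ler_wpM2l // ler_wpM2l.
have : 0 <= enorm v * (r * enorm v - 1) by rewrite mulr_ge0 // subr_ge0.
lra.
Qed.

(** * Convex combinations, lifting by one dimension and Jensen's inequality *)

Lemma convex_comb d (K : set (vec d)) N (p : 'I_N -> vec d) lam :
  convex_setE K -> (forall j, K (p j)) -> simplex lam -> K (\sum_j lam j *: p j).
Proof.
move=> convK; elim: N p lam => [|N IH] p lam Kp [l0 l1].
  by move: l1; rewrite big_ord0 => /eqP; rewrite eq_sym oner_eq0.
move: l1; rewrite !big_ord_recl; set t := lam ord0 => l1.
have [t1|t1] := eqVneq t 1.
  have S0 : \sum_(i < N) lam (lift ord0 i) = 0 by move: l1; rewrite t1; lra.
  have z := psumr_eq0P (fun i _ => l0 _) S0.
  rewrite big1 => [|i _]; first by rewrite addr0 t1 scale1r; exact: Kp.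
  by rewrite z // scale0r.
have tle : t <= 1 by rewrite -l1 lerDl; apply: sumr_ge0 => i _; exact: l0.
have t1' : 0 < 1 - t by rewrite subr_gt0 lt_def eq_sym t1.
have -> : \sum_(i < N) lam (lift ord0 i) *: p (lift ord0 i) =
    (1 - t) *: \sum_(i < N) (lam (lift ord0 i) / (1 - t)) *: p (lift ord0 i).
  rewrite scaler_sumr; apply: eq_bigr => i _.
  by rewrite scalerA mulrCA divff ?mulr1 // gt_eqF.
apply: convK (Kp _) _ (l0 _) tle; apply: IH => [j|]; first exact: Kp.
split=> [j|]; first by rewrite divr_ge0 // ltW.
rewrite -mulr_suml (_ : \sum_(i < N) _ = 1 - t) ?divff ?gt_eqF //; lra.
Qed.

Section Lift.
Context (d : nat).
Implicit Types (w : vec (1 + d)) (x : vec d) (a : R).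

Definition lift_vec a x : vec (1 + d) := row_mx a%:M x.
Definition hd w : R := w ord0 (lshift d ord0).
Definition tl w : vec d := rsubmx w.

Lemma hd_lift a x : hd (lift_vec a x) = a.
Proof. by rewrite /hd row_mxEl mxE eqxx mulr1n. Qed.

Lemma tl_lift a x : tl (lift_vec a x) = x.
Proof. exact: row_mxKr. Qed.

Lemma hdD w w' : hd (w + w') = hd w + hd w'. Proof. by rewrite /hd mxE. Qed.
Lemma hdN w : hd (- w) = - hd w. Proof. by rewrite /hd mxE. Qed.
Lemma hdZ a w : hd (a *: w) = a * hd w. Proof. by rewrite /hd mxE. Qed.
Lemma tlD w w' : tl (w + w') = tl w + tl w'. Proof. exact: linearD. Qed.
Lemma tlN w : tl (- w) = - tl w. Proof. exact: linearN. Qed.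
Lemma tlZ a w : tl (a *: w) = a *: tl w. Proof. exact: linearZ. Qed.

Lemma hd_sum N lam (w : 'I_N -> vec (1 + d)) :
  hd (\sum_j lam j *: w j) = \sum_j lam j * hd (w j).
Proof. by rewrite /hd summxE; apply: eq_bigr => j _; rewrite mxE. Qed.

Lemma tl_sum N lam (w : 'I_N -> vec (1 + d)) :
  tl (\sum_j lam j *: w j) = \sum_j lam j *: tl (w j).
Proof. by rewrite /tl linear_sum; apply: eq_bigr => j _; rewrite linearZ. Qed.

Lemma edot_hd_tl w w' : edot w w' = hd w * hd w' + edot (tl w) (tl w').
Proof.
rewrite /edot big_split_ord /= big_ord1; congr (_ + _).
by apply: eq_bigr => i _; rewrite !mxE.
Qed.

End Lift.

(** The hypograph of [l] over K is convex, so it contains the combination of the points (l(p_j),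
    p_j). *)
Lemma jensen_concave d (K : set (vec d)) l N (p : 'I_N -> vec d) lam :
  convex_setE K -> loss_concave K l -> (forall j, K (p j)) -> simplex lam ->
  \sum_j lam j * l (p j) <= l (\sum_j lam j *: p j).
Proof.
move=> convK cl Kp sl.
pose G := [set w : vec (1 + d) | K (tl w) /\ hd w <= l (tl w)].
have convG : convex_setE G.
  move=> w w' t [Kw hw] [Kw' hw'] t0 t1; rewrite /G /= tlD !tlZ hdD !hdZ.
  split; first exact: convK.
  apply: le_trans (cl _ _ _ Kw Kw' t0 t1).
  by rewrite lerD // ler_wpM2l // subr_ge0.
have [|_] := @convex_comb _ G _ (fun j => lift_vec (l (p j)) (p j)) lam convG _ sl.
  by move=> j; rewrite /G /= hd_lift tl_lift.
rewrite hd_sum tl_sum; under eq_bigr do rewrite hd_lift.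
by under [in leRHS]eq_bigr do rewrite tl_lift.
Qed.

Lemma closed_le_continuous (F : realType) (T : topologicalType) (f g : T -> F) :
  continuous f -> continuous g -> closed [set x | f x <= g x].
Proof.
move=> cf cg.
have -> : [set x | f x <= g x] = (fun x => g x - f x) @^-1` [set y | 0 <= y].
  by apply/seteqP; split=> x /=; rewrite subr_ge0.
apply: closed_comp; last exact: closed_ge.
by move=> x _; apply: cvgB; [exact: cg|exact: cf].
Qed.

Lemma hd_continuous (F : realType) d :
  continuous (fun w : 'rV[F]_(1 + d) => w ord0 (lshift d ord0)).
Proof. exact: coord_continuous. Qed.

Lemma tl_continuous (F : realType) d :
  continuous (fun w : 'rV[F]_(1 + d) => rsubmx w).
Proof.
rewrite (_ : rsubmx = fun w => \sum_j w ord0 j *: rsubmx (delta_mx ord0 j)).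
  exact: comb_continuous.
apply/funext => w; rewrite {1}[w]row_sum_delta linear_sum.
by apply: eq_bigr => j _; rewrite linearZ.
Qed.

Lemma continuous_cst (T U : topologicalType) (a : U) : continuous (fun _ : T => a).
Proof. by move=> x; exact: cst_continuous. Qed.

(** * The body above a paraboloid and nets with small variance *)

Section Paraboloid.
Context (d : nat) (K : set (vec d)) (x0 : vec d).
Hypotheses (cK : compact K) (convK : convex_setE K) (Kx0 : K x0).
Hypothesis Kball : forall x, K x -> edot (x - x0) (x - x0) <= 1.

(** The first coordinate is the height. The cap at height 1 makes the body bounded and, as K lies in
    the unit ball around [x0], cuts off no point of the graph. *)
Definition paraboloid := [set w : vec (1 + d) |
  K (tl w) /\ edot (tl w - x0) (tl w - x0) <= hd w <= 1].

Lemma paraboloid_bounded w : paraboloid w ->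
  edot (w - lift_vec 0 x0) (w - lift_vec 0 x0) <= 4.
Proof.
move=> [Kw /andP[h1 h2]].
rewrite edot_hd_tl hdD hdN tlD tlN hd_lift tl_lift subr0.
have h0 : 0 <= hd w by apply: le_trans h1; exact: edot_ge0.
have : hd w * hd w <= 1 by rewrite mulr_ile1.
by have := Kball Kw; lra.
Qed.

Lemma paraboloid_convex : convex_setE paraboloid.
Proof.
move=> w w' t [Kw /andP[h1 h2]] [Kw' /andP[h1' h2']] t0 t1.
rewrite /paraboloid /= tlD !tlZ hdD !hdZ; split; first exact: convK.
have t1' : 0 <= 1 - t by rewrite subr_ge0.
have := ler_wpM2l t0 h1; have := ler_wpM2l t1' h1'.
have := ler_wpM2l t0 h2; have := ler_wpM2l t1' h2'.
have -> : t *: tl w + (1 - t) *: tl w' - x0 =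
    t *: (tl w - x0) + (1 - t) *: (tl w' - x0).
  by apply/rowP => i; rewrite !mxE; ring.
(* This quantity is exactly the convexity defect of the squared norm. *)
have : 0 <= t * (1 - t) * edot ((tl w - x0) - (tl w' - x0)) ((tl w - x0) - (tl w' - x0)).
  by rewrite !mulr_ge0 // edot_ge0.
move: (tl w - x0) (tl w' - x0) => a b; rewrite !edotE (edotC b a).
move: (edot a a) (edot a b) (edot b b) => A B C h3 g1 g2 g3 g4.
apply/andP; split; last lra.
apply: le_trans (lerD g4 g3); rewrite -subr_ge0; move: h3.
by congr (0 <= _); ring.
Qed.

Lemma paraboloid_compact : compact paraboloid.
Proof.
pose c : vec (1 + d) := lift_vec 0 x0.
have cube : compact [set v : vec (1 + d) |
    forall j, `[c ord0 j - 2, c ord0 j + 2]%classic (v ord0 j)].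
  apply: (@rV_compact R _ (fun j => `[c ord0 j - 2, c ord0 j + 2]%classic)) => j.
  exact: segment_compact.
apply: subclosed_compact cube _; last first.
  move=> w pw j; rewrite /= in_itv /=.
  have := le_trans (sqr_coord_le (w - c) j) (paraboloid_bounded pw).
  rewrite !mxE -[_ ^+ 2]real_normK ?num_real // (_ : 4 = 2 ^+ 2); last by ring.
  rewrite ler_pXn2r ?nnegrE // ler_norml; lra.
have ct : continuous (fun w : vec (1 + d) => edot (tl w - x0) (tl w - x0)).
  apply: edot_continuous => w; apply: (continuous_comp (f := @tl d) (g := fun x => x - x0));
    by [exact: tl_continuous|exact: subr_cst_continuous].
have ch : continuous (@hd d) by exact: hd_continuous.
have -> : paraboloid = (@tl d) @^-1` K `&`
    ([set w | edot (tl w - x0) (tl w - x0) <= hd w] `&` [set w | hd w <= 1]).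
  apply/seteqP; split=> w /=; rewrite /paraboloid /=.
    by move=> [Kw /andP[h1 h2]].
  by move=> [Kw [h1 h2]]; split=> //; rewrite h1.
apply: closedI; last apply: closedI.
- apply: closed_comp; first by move=> x _; exact: tl_continuous.
  by apply: compact_closed => //; exact: norm_hausdorff.
- exact: closed_le_continuous.
- by apply: closed_le_continuous => //; exact: continuous_cst.
Qed.

End Paraboloid.

(** Approximate the lift (|y - x0|^2, y). The net points lie above the paraboloid, so the mean of
    |p_j - x0|^2 exceeds |y - x0|^2 by at most e = s^-2. Expanding around y, the second moment is
    this excess plus a cross term of size at most 2e. *)
Lemma quadratic_net d : exists C : R, 0 < C /\
  forall (K : set (vec d)) x0, compact K -> convex_setE K -> K x0 ->
  (forall x, K x -> edot (x - x0) (x - x0) <= 1) ->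
  forall s : R, 1 <= s ->
  exists N (p : 'I_N.+1 -> vec d),
    [/\ N.+1%:R <= C * s ^+ d, forall j, K (p j) &
      forall y, K y -> exists lam, [/\ simplex lam,
        enorm (\sum_j lam j *: p j - y) <= (s ^+ 2)^-1 &
        \sum_j lam j * edot (p j - y) (p j - y) <= 3 * (s ^+ 2)^-1]].
Proof.
have [C [C0 net]] := convex_net d; exists C; split=> // K x0 cK convK Kx0 Kball s s1.
have M0 : paraboloid K x0 !=set0.
  exists (lift_vec 0 x0); rewrite /paraboloid /= hd_lift tl_lift subrr edot0l lexx.
  by split=> //; exact: ler01.
have [N [p [NC Mp pnet]]] := net (paraboloid K x0) (lift_vec 0 x0)
  (paraboloid_compact cK Kball) (paraboloid_convex convK) M0 (paraboloid_bounded Kball) s s1.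
exists N, (fun j => tl (p j)); split=> // [j|y Ky]; first by case: (Mp j).
pose Q x := edot (x - x0) (x - x0).
have [|lam [sl lamy]] := pnet (lift_vec (Q y) y).
  by rewrite /paraboloid /= hd_lift tl_lift; split=> //; rewrite lexx Kball.
have [l0 l1] := sl; exists lam.
set e := (s ^+ 2)^-1 in lamy *; have e0 : 0 < e by rewrite invr_gt0 exprn_gt0; lra.
set z := \sum_j lam j *: tl (p j).
move: lamy; rewrite (enorm_leP _ (ltW e0)) edot_hd_tl !hdD !hdN !tlD !tlN.
rewrite hd_lift tl_lift hd_sum tl_sum -/z => lamy.
set h := \sum_j _ in lamy.
have zy : edot (z - y) (z - y) <= e ^+ 2.
  by apply: le_trans lamy; rewrite lerDr -expr2 sqr_ge0.
have hQ : h <= Q y + e.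
  suff : `|h - Q y| <= e by rewrite ler_norml; lra.
  rewrite -(@ler_pXn2r _ 2) ?nnegrE ?(ltW e0) // real_normK ?num_real //.
  by apply: le_trans lamy; rewrite -expr2 lerDl edot_ge0.
split=> //; first by rewrite (enorm_leP _ (ltW e0)).
have Qh : \sum_j lam j * Q (tl (p j)) <= h.
  by apply: ler_sum => j _; rewrite ler_wpM2l //; case: (Mp j) => _ /andP[].
have -> : \sum_j lam j * edot (tl (p j) - y) (tl (p j) - y) =
    \sum_j lam j * Q (tl (p j)) - 2 * edot (z - y) (y - x0) - Q y.
  have -> : z - y = \sum_j lam j *: (tl (p j) - y).
    under eq_bigr do rewrite scalerBr.
    by rewrite sumrB -scaler_suml l1 scale1r.
  rewrite [X in _ - X](_ : Q y = \sum_j lam j * Q y); last first.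
    by rewrite -mulr_suml l1 mul1r.
  rewrite edot_suml mulr_sumr -!sumrB; apply: eq_bigr => j _.
  rewrite /Q (_ : tl (p j) - x0 = (tl (p j) - y) + (y - x0)); last by rewrite addrA subrK.
  move: (tl (p j) - y) (y - x0) => a b; rewrite !edotE (edotC b a); ring.
(* Cauchy-Schwarz for the cross term: with |u| <= e and |b| <= 1, nonnegativity of |u + e b|^2
   yields -<u, b> <= e. *)
move: (edot_ge0 ((z - y) + e *: (y - x0))) zy (Kball _ Ky).
move: (z - y) (y - x0) => u b; rewrite !edotE (edotC b u) => hh uu bb.
have : 0 <= e * (2 * e + 2 * edot u b).
  have : e * e * edot b b <= e * e by rewrite ler_piMr // mulr_ge0 // ltW.
  lra.
rewrite pmulr_rge0 //; lra.
Qed.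

(** * Rounding errors for concave, Lipschitz and smooth losses *)

Lemma linear_comb0 (F : realType) n N (f : {linear 'rV[F]_n -> F^o}) lam
    (u : 'I_N -> 'rV[F]_n) :
  \sum_j lam j *: u j = 0 -> \sum_j lam j * f (u j) = 0.
Proof.
move=> u0; transitivity (f (\sum_j lam j *: u j)); last by rewrite u0 linear0.
by rewrite linear_sum; apply: eq_bigr => j _; rewrite linearZ.
Qed.

Section Rounding.
Context (d N : nat) (K : set (vec d)) (p : 'I_N -> vec d).
Hypotheses (convK : convex_setE K) (Kp : forall j, K (p j)).

Lemma roundable_sub (P P' : (vec d -> R) -> Prop) e :
  (forall l, P' l -> P l) -> roundable K P p e -> roundable K P' p e.
Proof.
move=> sub rnd y /rnd[lam [sl lamP]]; exists lam; split=> // l /sub; exact: lamP.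
Qed.

(** Jensen works in the favourable direction, so only the distance from the mean to [y] is paid
    for. *)
Lemma roundable_concave L e : 0 <= L ->
  (forall y, K y -> exists lam, simplex lam /\ enorm (\sum_j lam j *: p j - y) <= e) ->
  roundable K (fun l => loss_lipschitz K L l /\ loss_concave K l) p (L * e).
Proof.
move=> L0 net y Ky; have [lam [sl lamy]] := net y Ky; exists lam; split=> // l [lip cl].
apply: le_trans (jensen_concave convK cl Kp sl) _.
have := lip _ _ (convex_comb convK Kp sl) Ky; move=> /(le_trans (ler_norm _)).
by have := ler_wpM2l L0 lamy; lra.
Qed.

Context (s : R).
Hypothesis s1 : 1 <= s.
Hypothesis net : forall y, K y -> exists lam, [/\ simplex lam,
  enorm (\sum_j lam j *: p j - y) <= (s ^+ 2)^-1 &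
  \sum_j lam j * edot (p j - y) (p j - y) <= 3 * (s ^+ 2)^-1].

(** The inequality a <= (1/s + s a^2)/2 turns the second moment 3/s^2 into a mean distance of at
    most 2/s. *)
Lemma roundable_lipschitz L : 0 <= L -> roundable K (loss_lipschitz K L) p (2 * L / s).
Proof.
move=> L0 y Ky; have [lam [sl _ var]] := net Ky; exists lam; split=> // l lip.
have [l0 l1] := sl; have s0 : 0 < s := lt_le_trans ltr01 s1.
apply: (@le_trans _ _ (\sum_j lam j *
    (l y + L * ((s^-1 + s * edot (p j - y) (p j - y)) / 2)))).
  apply: ler_sum => j _; rewrite ler_wpM2l // -lerBlDl.
  apply: le_trans (ler_norm _) _; apply: le_trans (lip _ _ (Kp j) Ky) _.
  rewrite ler_wpM2l // -enorm_sqr; move: (enorm _) => a.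
  rewrite -subr_ge0 (_ : _ - a = s / 2 * (a - s^-1) ^+ 2); last first.
    by field; rewrite gt_eqF.
  by rewrite mulr_ge0 ?sqr_ge0 // divr_ge0 // ltW.
have -> : \sum_j lam j * (l y + L * ((s^-1 + s * edot (p j - y) (p j - y)) / 2)) =
    l y + L * ((s^-1 + s * \sum_j lam j * edot (p j - y) (p j - y)) / 2).
  transitivity (\sum_j lam j * (l y + L * s^-1 / 2) + L * s / 2 *
      \sum_j lam j * edot (p j - y) (p j - y)).
    rewrite mulr_sumr -big_split /=; apply: eq_bigr => j _; field.
    by rewrite gt_eqF.
  by rewrite -mulr_suml l1; field; rewrite gt_eqF.
rewrite lerD2l (_ : 2 * L / s = L * ((s^-1 + s * (3 * (s ^+ 2)^-1)) / 2)); last first.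
  by field; rewrite gt_eqF.
rewrite ler_wpM2l // ler_pM2r // lerD2l ler_pM2l //.
Qed.

(** Expanding at the mean z kills the linear terms, and the variance about z is at most the second
    moment about [y]. Passing from z to [y] costs L/s^2 by the Lipschitz bound. *)
Lemma roundable_smooth L beta : 0 <= L -> 0 <= beta ->
  roundable K (fun l => loss_lipschitz K L l /\ loss_smooth K beta l) p
    ((L + 2 * beta) / s ^+ 2).
Proof.
move=> L0 b0 y Ky; have [lam [sl lamy var]] := net Ky; exists lam; split=> // l [lip sm].
have [l0 l1] := sl; set z := \sum_j lam j *: p j in lamy *.
have Kz : K z by exact: convex_comb.
have zmean : \sum_j lam j *: (p j - z) = 0.
  under eq_bigr do rewrite scalerBr.
  by rewrite sumrB -scaler_suml l1 scale1r subrr.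
have [_ smz] := sm z Kz.
have lz : l z <= l y + L * (s ^+ 2)^-1.
  have := lip _ _ Kz Ky; move=> /(le_trans (ler_norm _)).
  by have := ler_wpM2l L0 lamy; lra.
have D0 : \sum_j lam j * 'd (l : vec d -> R^o) z (p j - z) = 0.
  exact: (@linear_comb0 R _ _ ('d (l : vec d -> R^o) z) lam _ zmean).
have varz : \sum_j lam j * edot (p j - z) (p j - z) <=
    \sum_j lam j * edot (p j - y) (p j - y).
  have -> : \sum_j lam j * edot (p j - y) (p j - y) =
      \sum_j lam j * edot (p j - z) (p j - z) + 2 * edot (\sum_j lam j *: (p j - z)) (z - y)
      + edot (z - y) (z - y).
    rewrite edot_suml [X in _ + X](_ : _ = \sum_j lam j * edot (z - y) (z - y)); last first.
      by rewrite -mulr_suml l1 mul1r.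
    rewrite mulr_sumr -!big_split /=; apply: eq_bigr => j _.
    rewrite (_ : p j - y = (p j - z) + (z - y)); last by rewrite addrA subrK.
    move: (p j - z) (z - y) => a b; rewrite !edotE (edotC b a); ring.
  by rewrite zmean edot0l mulr0 addr0 lerDl edot_ge0.
apply: (@le_trans _ _ (\sum_j lam j * (l z + 'd (l : vec d -> R^o) z (p j - z) +
    beta / 2 * edot (p j - z) (p j - z)))).
  apply: ler_sum => j _; rewrite ler_wpM2l //.
  by have := smz _ (Kp j); rewrite enorm_sqr; lra.
have -> : \sum_j lam j * (l z + 'd (l : vec d -> R^o) z (p j - z) +
    beta / 2 * edot (p j - z) (p j - z)) =
    l z + beta / 2 * \sum_j lam j * edot (p j - z) (p j - z).
  under eq_bigr do rewrite !mulrDr.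
  rewrite !big_split /= D0 addr0 -mulr_suml l1 mul1r mulr_sumr; congr (_ + _).
  by apply: eq_bigr => j _; rewrite mulrCA.
have s2 : 0 <= (s ^+ 2)^-1 by rewrite invr_ge0 sqr_ge0.
have bv : beta / 2 * \sum_j lam j * edot (p j - z) (p j - z) <=
    beta / 2 * (3 * (s ^+ 2)^-1).
  by rewrite ler_wpM2l ?divr_ge0 //; exact: le_trans varz var.
have := mulr_ge0 b0 s2; lra.
Qed.

End Rounding.

(** * Regret rates in terms of the scale of the net *)

Lemma ln_ge_half (T : nat) : (2 <= T)%N -> 1 <= 2 * ln (T%:R : R).
Proof.
move=> T2; have T0 : 0 < T%:R :> R by rewrite ltr0n (leq_trans _ T2).
have TR : 2 <= T%:R :> R by rewrite ler_nat.
have : ln (1 + (T%:R^-1 - 1)) <= (T%:R : R)^-1 - 1.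
  by apply: le_ln1Dx; have := invr_gt0 (T%:R : R); rewrite T0; lra.
have : (T%:R : R)^-1 <= 2^-1 by rewrite lef_pV2 ?posrE.
rewrite (addrC 1) subrK lnV ?posrE //; lra.
Qed.

Lemma ln1D_le (T : nat) : (2 <= T)%N -> ln (1 + T%:R : R) <= 2 * ln (T%:R : R).
Proof.
move=> T2; have TR : 2 <= T%:R :> R by rewrite ler_nat.
have -> : 2 * ln (T%:R : R) = ln ((T%:R : R) ^+ 2) by rewrite lnXn ?mulr_natl //; lra.
have a0 : 0 < 1 + T%:R :> R by lra.
have b0 : 0 < (T%:R : R) ^+ 2 by rewrite exprn_gt0; lra.
by rewrite ler_ln ?posrE //; nra.
Qed.

Section Rates.
Context (d N : nat) (K : set (vec d)) (P : (vec d -> R) -> Prop) (p : 'I_N.+1 -> vec d).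
Context (T : nat) (L C s : R).
Hypotheses (Kp : forall j, K (p j)) (T2 : (2 <= T)%N) (L0 : 0 < L).
Hypotheses (Plip : forall l, P l -> loss_lipschitz K L l).
Hypotheses (C1 : 1 <= C) (s1 : 1 <= s).
Let s0 : 0 < s := lt_le_trans ltr01 s1.

(** Here [k] is the exponent of the net size and [m] the order of the rounding error. The choice T =
    s^(k+2m) makes both the learning cost and the rounding cost of order s^(k+m), up to the
    logarithm. *)
Lemma hedge_rate k m E : 0 <= E ->
  (forall x y, K x -> K y -> enorm (x - y) <= 1) ->
  N.+1%:R <= C * s ^+ k -> T%:R = s ^+ (k + m + m) ->
  roundable K P p (E / s ^+ m) ->
  swap_achievable K T P
    ((2 * C * (2 * ln C + 1) + 2) * (L + E) * s ^+ (k + m) * ln T%:R).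
Proof.
move=> E0 diam NC TE rnd; have Tln := ln_ge_half T2.
have sm0 : 0 < s ^+ m by rewrite exprn_gt0.
have sm1 : 1 <= s ^+ m by rewrite exprn_ege1.
(* This makes [eta * L ^+ 2] of the order L/s^m of the rounding error; the factor 2 ensures
   [eta * L <= 1 / 2]. *)
pose eta := (2 * L * s ^+ m)^-1.
have eta0 : 0 < eta by rewrite invr_gt0 !mulr_gt0.
have Pdiff l : P l -> forall j k, `|l (p j) - l (p k)| <= L.
  move=> Pl i j; apply: le_trans (Plip Pl (Kp i) (Kp j)) _.
  by rewrite ler_piMr ?diam // ltW.
have etaL : eta * L <= 1 / 2.
  have -> : eta * L = (s ^+ m)^-1 / 2 by rewrite /eta; field; rewrite ?gt_eqF.
  by rewrite ler_pM2r // invf_le1.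
have := swap_achievable_of_weighted_regret Kp
  (hedge_weighted_regret T eta0 (ltW L0) etaL Pdiff rnd).
apply: swap_achievable_le.
have C0 : 0 < C := lt_le_trans ltr01 C1.
have lnC : 0 <= ln C by rewrite ln_ge0.
have lnN : ln N.+1%:R <= (2 * ln C + 1) * ln T%:R.
  apply: (@le_trans _ _ (ln (C * T%:R))).
    rewrite ler_ln ?posrE ?ltr0n ?mulr_gt0 ?ltr0n ?(leq_trans _ T2) //.
    apply: le_trans NC _; rewrite ler_wpM2l ?(ltW C0) // TE -addnA exprD.
    by rewrite ler_peMr ?exprn_ge0 ?exprn_ege1 // ltW.
  rewrite lnM ?posrE ?ltr0n ?(leq_trans _ T2) //.
  have := ler_wpM2l lnC Tln; lra.
set lT := ln T%:R in lnN Tln *.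
have lT0 : 0 <= lT by lra.
have S0 : 0 < s ^+ (k + m) by rewrite exprn_gt0.
have first : N.+1%:R * (ln N.+1%:R / eta) <=
    2 * C * (2 * ln C + 1) * L * s ^+ (k + m) * lT.
  rewrite /eta invrK.
  apply: (@le_trans _ _ ((C * s ^+ k) * ((2 * ln C + 1) * lT * (2 * L * s ^+ m)))).
    apply: ler_pM => //; first by rewrite mulr_ge0 ?ln_ge0 ?ler1n // ltW // !mulr_gt0.
    by rewrite ler_wpM2r // ltW // !mulr_gt0.
  by rewrite exprD le_eqVlt; apply/orP; left; apply/eqP; ring.
have second : (2 * eta * L ^+ 2 + E / s ^+ m) * T%:R = (L + E) * s ^+ (k + m).
  by rewrite TE /eta exprD; field; rewrite ?gt_eqF.
rewrite second; apply: le_trans (lerD first (lexx _)) _.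
have LE0 : 0 <= (L + E) * s ^+ (k + m) by rewrite mulr_ge0 ?addr_ge0 // ltW.
have h1 := ler_wpM2l LE0 Tln.
have h2 : 0 <= 2 * C * (2 * ln C + 1) * E * s ^+ (k + m) * lT.
  by rewrite !mulr_ge0 ?addr_ge0 ?mulr_ge0 // ltW.
lra.
Qed.

(** The scale is left free here, because cases (iv) and (v) balance the two terms differently. *)
Lemma ftl_rate alpha e k : compact K -> convex_setE K -> 0 < alpha ->
  (forall l, P l -> loss_strongly_convex K alpha l) ->
  N.+1%:R <= C * s ^+ k -> 0 <= e -> roundable K P p e ->
  swap_achievable K T P
    ((16 * C * (s ^+ k * (L ^+ 2 / alpha)) + 2 * (e * T%:R)) * ln T%:R).
Proof.
move=> cK convK alpha0 Psc NC e0 rnd; have Tln := ln_ge_half T2.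
have K0 : K !=set0 by exists (p ord0).
have := swap_achievable_of_weighted_regret Kp
  (ftl_weighted_regret cK convK K0 (ltW L0) alpha0 T Plip Psc rnd).
apply: swap_achievable_le.
set X := L ^+ 2 / alpha.
have X0 : 0 <= X by rewrite divr_ge0 ?sqr_ge0 // ltW.
rewrite (_ : 8 * L ^+ 2 / alpha = 8 * X); last by rewrite /X mulrA.
have eT : 0 <= e * T%:R by rewrite mulr_ge0.
have h1 := ler_wpM2l eT Tln.
have lT0 : 0 <= ln (1 + T%:R : R) by rewrite ln_ge0 // lerDl ler0n.
have h2 : N.+1%:R * (8 * X * ln (1 + T%:R)) <= C * s ^+ k * (8 * X * (2 * ln T%:R)).
  have X8 : 0 <= 8 * X by exact: mulr_ge0.
  apply: ler_pM (mulr_ge0 X8 lT0) NC _; first exact: ler0n.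
  by rewrite ler_wpM2l // ln1D_le.
lra.
Qed.

End Rates.

(** * Roots of the horizon and consequences of diameter one *)

Lemma powR_root (x : R) k n : 0 <= x ->
  x `^ (k%:R / n.+1%:R) = (x `^ n.+1%:R^-1) ^+ k.
Proof. by move=> x0; rewrite mulrC powRrM powR_mulrn // powR_ge0. Qed.

Lemma powR_rootK (x : R) n : 0 <= x -> (x `^ n.+1%:R^-1) ^+ n.+1 = x.
Proof. by move=> x0; rewrite -powR_root // divff ?pnatr_eq0 // powRr1. Qed.

Lemma powR_root_ge1 (x : R) n : 1 <= x -> 1 <= x `^ n.+1%:R^-1.
Proof.
move=> x1; rewrite -(@ler_pXn2r _ n.+1) ?nnegrE ?powR_ge0 // powR_rootK ?expr1n //.
exact: le_trans x1.
Qed.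

Section Diameter.
Context (d : nat) (K : set (vec d)).
Hypothesis diam1 : set_diameter K = 1.

(** A set without a supremum gets the default value 0, so diameter 1 certifies that the distances
    form a nonempty bounded set. *)
Lemma diameter_has_sup : has_sup [set enorm (x - y) | x in K & y in K].
Proof.
apply: contrapT => /sup_out; rewrite -/(set_diameter K) diam1 => /eqP.
by rewrite oner_eq0.
Qed.

Lemma diameter_nonempty : K !=set0.
Proof. by have [[_ [x Kx _]] _] := diameter_has_sup; exists x. Qed.

Lemma diameter_le1 x y : K x -> K y -> enorm (x - y) <= 1.
Proof.
move=> Kx Ky; rewrite -diam1; apply: ub_le_sup; first by case: diameter_has_sup.
by exists x => //; exists y.
Qed.

(** For two points at distance a > 1/2, the midpoint inequality against the Lipschitz bound gives
    alpha a^2 / 8 <= L a / 2. In case (v) this absorbs [L] into L^2/alpha. *)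
Lemma strong_convexity_le_lipschitz L alpha l : compact K -> convex_setE K ->
  0 < alpha -> loss_lipschitz K L l -> loss_strongly_convex K alpha l -> alpha <= 8 * L.
Proof.
move=> cK convK alpha0 lip sc.
have h2 : 0 < 1 / 2 :> R by [].
have [_ [x Kx [y Ky <-]]] := sup_adherent h2 diameter_has_sup.
rewrite -/(set_diameter K) diam1 => xy.
have := strongly_convex_midpoint cK convK alpha0 lip sc Kx Ky.
set m := _ + _; have Km : K m by apply: convK => //; lra.
have := lip _ _ Kx Km; have := lip _ _ Ky Km.
have -> : x - m = (1 / 2) *: (x - y) by apply/rowP => i; rewrite !mxE; field.
have -> : y - m = (1 / 2) *: (y - x) by apply/rowP => i; rewrite !mxE; field.
have nh u : enorm ((1 / 2) *: u : vec d) = 1 / 2 * enorm u.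
  by rewrite /enorm edotZl edotZr mulrA -expr2 sqrtrM ?sqr_ge0 // sqrtr_sqr ger0_norm.
rewrite !nh (enormB y) -enorm_sqr => /(le_trans (ler_norm _)) h3 /(le_trans (ler_norm _)) h4.
move: (enorm (x - y)) xy h3 h4 => a a2 h3 h4 h5.
have a0 : 0 < a by lra.
have : alpha * a * a <= 4 * L * a by lra.
rewrite ler_pM2r // => h6.
have : alpha * (1 / 2) <= alpha * a by rewrite ler_pM2l //; lra.
lra.
Qed.

End Diameter.

(** * Choice of scales in the five cases *)

Lemma rate_const_ge0 (C : R) : 1 <= C -> 0 <= 2 * C * (2 * ln C + 1) + 2.
Proof.
move=> C1; have C0 : 0 <= C by exact: le_trans C1.
by rewrite addr_ge0 // !mulr_ge0 // addr_ge0 // mulr_ge0 // ln_ge0.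
Qed.

Lemma ler_pM3 (C C' B B' X Y : R) : 0 <= C -> C <= C' -> 0 <= B -> B <= B' ->
  0 <= X -> 0 <= Y -> C * B * X * Y <= C' * B' * X * Y.
Proof.
move=> C0 CC B0 BB X0 Y0; apply: ler_wpM2r => //; apply: ler_wpM2r => //.
exact: ler_pM.
Qed.

Theorem theorem3 (d : nat) : (1 <= d)%N ->
  exists C : R,
  forall K : set 'rV[R]_d, compact K -> convex_setE K -> set_diameter K = 1 ->
  forall L : R, 0 < L ->
  forall T : nat, (2 <= T)%N ->
  let Tr : R := T%:R in
  [/\ (* (i) L-Lipschitz losses *)
      swap_achievable K T (loss_lipschitz K L)
        (C * L * Tr `^ (d.+1%:R / d.+2%:R) * ln Tr),
      (* (ii) L-Lipschitz and beta-smooth *)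
      forall beta : R, 0 < beta ->
      swap_achievable K T (fun l => loss_lipschitz K L l /\ loss_smooth K beta l)
        (C * (L + beta) * Tr `^ (d.+2%:R / d.+4%:R) * ln Tr),
      (* (iii) L-Lipschitz and concave *)
      swap_achievable K T (fun l => loss_lipschitz K L l /\ loss_concave K l)
        (C * L * Tr `^ (d.+1%:R / d.+3%:R) * ln Tr),
      (* (iv) L-Lipschitz and alpha-strongly convex *)
      forall alpha : R, 0 < alpha ->
      swap_achievable K T (fun l => loss_lipschitz K L l /\ loss_strongly_convex K alpha l)
        (C * L * (L / alpha) `^ (1 / d.+1%:R) * Tr `^ (d%:R / d.+1%:R) * ln Tr)
    & (* (v) L-Lipschitz, alpha-strongly convex and beta-smooth *)
      forall alpha beta : R, 0 < alpha -> 0 < beta ->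
      swap_achievable K T
        (fun l => [/\ loss_lipschitz K L l, loss_strongly_convex K alpha l & loss_smooth K beta l])
        (C * L * (beta / L + L / alpha) * Tr `^ (d%:R / d.+2%:R) * ln Tr)].
Proof.
case: d => // n _.
have [C1 [C10 qnet]] := quadratic_net n.+1.
have [C2 [C20 cnet]] := convex_net n.
pose A (C : R) := 2 * C * (2 * ln C + 1) + 2.
(* Adding 1 makes the net constants at least 1, so their logarithms are nonnegative. *)
pose D1 := 1 + C1; pose D2 := 1 + C2.
have D11 : 1 <= D1 by rewrite lerDl ltW.
have D21 : 1 <= D2 by rewrite lerDl ltW.
have A1 : 0 <= A D1 := rate_const_ge0 D11.
have A2 : 0 <= A D2 := rate_const_ge0 D21.
pose C0 := 3 * A D1 + 3 * A D2 + 16 * D1 + 16.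
exists C0 => K cK convK diam L L0 T T2 Tr.
have CA1 : A D1 * 3 <= C0 by rewrite /C0; lra.
have CA2 : A D2 * 3 <= C0 by rewrite /C0; lra.
have CD : 16 * D1 + 16 <= C0 by rewrite /C0; lra.
clearbody C0.
have [x0 Kx0] := diameter_nonempty diam.
have K0 : K !=set0 by exists x0.
have Kdiam := diameter_le1 diam.
have Kball x : K x -> edot (x - x0) (x - x0) <= 1.
  by move=> Kx; rewrite -(expr1n _ 2) -enorm_leP // Kdiam.
have Tr2 : 2 <= Tr by rewrite ler_nat.
have Tr1 : 1 <= Tr by lra.
have Tr0 : 0 <= Tr by lra.
have lnT := ln_ge_half T2; rewrite -/Tr in lnT.
have lnT0 : 0 <= ln Tr by lra.
have wide (C' s : R) k : 0 < s -> C' * s ^+ k <= (1 + C') * s ^+ k.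
  by move=> s0; rewrite ler_wpM2r ?lerDr ?ler01 // exprn_ge0 // ltW.
pose root k := Tr `^ k.+1%:R^-1.
have root1 k : 1 <= root k by exact: powR_root_ge1.
have rootK k : root k ^+ k.+1 = Tr by exact: powR_rootK.
have rootX k j : Tr `^ (j%:R / k.+1%:R) = root k ^+ j by exact: powR_root.
have rootX0 k j : 0 <= root k ^+ j by rewrite exprn_ge0 // (le_trans ler01 (root1 k)).
split.
(* Case (i): s^d points with error of order 1/s, so T = s^(d+2), where d is [n.+1]. *)
- have [N [p [NC Kp net]]] := qnet K x0 cK convK Kx0 Kball _ (root1 n.+2).
  have s0 := lt_le_trans ltr01 (root1 n.+2).
  have rnd := roundable_lipschitz Kp (root1 _) net (ltW L0).
  have := hedge_rate Kp T2 L0 (fun l => id) D11 (root1 n.+2) (k := n.+1) (m := 1)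
    (E := 2 * L) _ Kdiam (le_trans NC (wide _ _ _ s0)) _ rnd.
  rewrite -/Tr !addn1 rootK rootX => /(_ _ erefl); rewrite mulr_ge0 ?ltW // => /(_ isT).
  apply: swap_achievable_le.
  rewrite (_ : L + 2 * L = 3 * L) -/(A D1) 1?(mulrA (A D1) 3); last by ring.
  by apply: ler_pM3 (mulr_ge0 A1 _) CA1 (ltW L0) _ _ _.
(* Case (ii): s^d points with error of order 1/s^2, so T = s^(d+4). *)
- move=> beta beta0.
  have [N [p [NC Kp net]]] := qnet K x0 cK convK Kx0 Kball _ (root1 n.+4).
  have s0 := lt_le_trans ltr01 (root1 n.+4).
  have rnd := roundable_smooth convK Kp net (ltW L0) (ltW beta0).
  have := hedge_rate Kp T2 L0 (fun l => @proj1 _ _) D11 (root1 n.+4) (k := n.+1) (m := 2)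
    (E := L + 2 * beta) _ Kdiam (le_trans NC (wide _ _ _ s0)) _ rnd.
  rewrite -/Tr !addn2 rootK rootX => /(_ _ erefl).
  have E0 : 0 <= L + 2 * beta by rewrite addr_ge0 ?mulr_ge0 // ltW.
  move=> /(_ E0); apply: swap_achievable_le.
  rewrite (_ : L + (L + 2 * beta) = 2 * (L + beta)) -/(A D1) 1?(mulrA (A D1) 2); last by ring.
  have CA1' : A D1 * 2 <= C0 by lra.
  by apply: ler_pM3 (mulr_ge0 A1 _) CA1' (addr_ge0 (ltW L0) (ltW beta0)) _ _ _.
(* Case (iii): without the lift s^(d-1) points suffice for error 1/s^2, so T = s^(d+3). *)
- have ball4 x : K x -> edot (x - x0) (x - x0) <= 4 by move=> /Kball; lra.
  have [N [p [NC Kp net]]] := cnet K x0 cK convK K0 ball4 _ (root1 n.+3).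
  have s0 := lt_le_trans ltr01 (root1 n.+3).
  have rnd := roundable_concave convK Kp (ltW L0) net.
  have := hedge_rate Kp T2 L0 (fun l => @proj1 _ _) D21 (root1 n.+3) (k := n) (m := 2)
    (E := L) (ltW L0) Kdiam (le_trans NC (wide _ _ _ s0)) _ rnd.
  rewrite -/Tr !addn2 rootK rootX => /(_ erefl).
  apply: swap_achievable_le.
  rewrite (_ : L + L = 2 * L) -/(A D2) 1?(mulrA (A D2) 2); last by ring.
  have CA2' : A D2 * 2 <= C0 by lra.
  by apply: ler_pM3 (mulr_ge0 A2 _) CA2' (ltW L0) _ _ _.
- move=> alpha alpha0; rewrite rootX div1r.
  have La0 : 0 <= L / alpha by rewrite divr_ge0 // ltW.
  set a := (L / alpha) `^ _; set b := root n.+1.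
  have aK : a ^+ n.+2 = L / alpha by exact: powR_rootK.
  have bK : b ^+ n.+2 = Tr by exact: rootK.
  have a0 : 0 < a by rewrite powR_gt0 // divr_gt0.
  have b1 : 1 <= b := root1 _; have b0 : 0 < b := lt_le_trans ltr01 b1.
  have Lb0 : 0 <= L * a * b ^+ n.+1 by rewrite !mulr_ge0 ?exprn_ge0 // ltW.
  (* If b < a the scale b/a drops below 1, but then the trivial bound LT = L b b^d is already at
     most L a b^d. *)
  have [ba|ab] := ltP b a.
    have Plip l : loss_lipschitz K L l /\ loss_strongly_convex K alpha l ->
      loss_lipschitz K L l by case.
    have := swap_achievable_trivial T K0 (ltW L0) Kdiam Plip.
    apply: swap_achievable_le.
    apply: (@le_trans _ _ (L * a * b ^+ n.+1)).
      rewrite -/Tr -bK exprS mulrA ler_wpM2r ?exprn_ge0 ?(ltW b0) //.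
      by apply: ler_wpM2l; exact: ltW.
    have h1 := ler_wpM2l Lb0 lnT.
    have Lln0 : 0 <= L * a * b ^+ n.+1 * ln Tr by rewrite mulr_ge0.
    have C2' : 2 <= C0 by lra.
    have := ler_wpM2r Lln0 C2'; lra.
  (* Since a^(d+1) = L/alpha and b^(d+1) = T, this scale makes both s^d L^2/alpha and LT/s equal to
     L a b^d. *)
  pose s := b / a.
  have s1 : 1 <= s by rewrite ler_pdivlMr // mul1r.
  have [N [p [NC Kp net]]] := qnet K x0 cK convK Kx0 Kball _ s1.
  have s0 := lt_le_trans ltr01 s1.
  have rnd : roundable K (fun l => loss_lipschitz K L l /\ loss_strongly_convex K alpha l)
      p (2 * L / s).
    by apply: roundable_sub (roundable_lipschitz Kp s1 net (ltW L0)) => l [].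
  have e0 : 0 <= 2 * L / s by exact: divr_ge0 (mulr_ge0 (ler0n _ 2) (ltW L0)) (ltW s0).
  have := ftl_rate Kp T2 L0 (fun l => @proj1 _ _) cK convK alpha0
    (fun l => @proj2 _ _) (le_trans NC (wide _ _ _ s0)) e0 rnd.
  apply: swap_achievable_le; rewrite -/Tr -/D1.
  have -> : s ^+ n.+1 * (L ^+ 2 / alpha) = L * a * b ^+ n.+1.
    rewrite expr2 -mulrA -aK /s expr_div_n [in X in _ * (L * X)]exprS.
    by field; rewrite expf_neq0 // gt_eqF.
  have -> : 2 * L / s * Tr = 2 * (L * a * b ^+ n.+1).
    by rewrite -bK /s exprS; field; rewrite !gt_eqF.
  have Lln0 : 0 <= L * a * b ^+ n.+1 * ln Tr by rewrite mulr_ge0.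
  have C4 : 16 * D1 + 4 <= C0 by apply: le_trans CD; rewrite lerD2l ler_nat.
  have := ler_wpM2r Lln0 C4; move: (D1) => D; lra.
- move=> alpha beta alpha0 beta0; rewrite rootX.
  set P := (X in swap_achievable K T X).
  (* Case (v): an admissible loss is needed to know [alpha <= 8 * L]. With T = s^(d+2) both costs
     are then multiples of s^d. *)
  have [[l0 [lip0 sc0 _]]|noP] := pselect (exists l, P l); last first.
    by apply: swap_achievable_vacuous => // l Pl; apply: noP; exists l.
  have aL := strong_convexity_le_lipschitz diam cK convK alpha0 lip0 sc0.
  have [N [p [NC Kp net]]] := qnet K x0 cK convK Kx0 Kball _ (root1 n.+2).
  have s0 := lt_le_trans ltr01 (root1 n.+2).
  have Plip l : P l -> loss_lipschitz K L l by case.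
  have Psc l : P l -> loss_strongly_convex K alpha l by case.
  have rnd : roundable K P p ((L + 2 * beta) / root n.+2 ^+ 2).
    by apply: roundable_sub (roundable_smooth convK Kp net (ltW L0) (ltW beta0)) => l [].
  have e0 : 0 <= (L + 2 * beta) / root n.+2 ^+ 2.
    exact: divr_ge0 (addr_ge0 (ltW L0) (mulr_ge0 (ler0n _ 2) (ltW beta0))) (rootX0 _ 2).
  have := ftl_rate Kp T2 L0 Plip cK convK alpha0 Psc
    (le_trans NC (wide _ _ _ s0)) e0 rnd.
  apply: swap_achievable_le; rewrite -/Tr -/D1.
  set b := root n.+2 in s0 *; set X := L ^+ 2 / alpha.
  have X0 : 0 <= X by rewrite divr_ge0 ?exprn_ge0 // ltW.
  have LX : L <= 8 * X.
    rewrite /X mulrA ler_pdivlMr // expr2 mulrA mulrC ler_wpM2r // ltW //.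
  have -> : (L + 2 * beta) / b ^+ 2 * Tr = (L + 2 * beta) * b ^+ n.+1.
    by rewrite -(rootK n.+2) -/b !exprS; field; rewrite gt_eqF.
  rewrite (_ : C0 * L * (beta / L + L / alpha) = C0 * (beta + X)); last first.
    by rewrite /X; field; rewrite !gt_eqF.
  have Y0 : 0 <= b ^+ n.+1 * ln Tr by exact: mulr_ge0 (rootX0 _ _) lnT0.
  have main : 16 * D1 * X + 2 * (L + 2 * beta) <= C0 * (beta + X).
    have bX : 0 <= beta + X by rewrite addr_ge0 // ltW.
    have h1 := ler_wpM2r bX CD.
    have h2 : 0 <= 16 * D1 * beta
      by exact: mulr_ge0 (mulr_ge0 (ler0n _ 16) (le_trans ler01 D11)) (ltW beta0).
    lra.
  have := ler_wpM2r Y0 main; move: (D1) => D; lra.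
Qed.
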